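(* Let $M$ be an oriented one-cusped hyperbolic 3-manifold with invariant trace field $E_M$ and a fixed meridian class on its boundary torus, and let $\mathcal T$ be a regular ideal triangulation of $M$ with $N$ tetrahedra. For an enhanced Neumann–Zagier datum $(z,\mathbf A,\mathbf B,f)$ of $\mathcal T$ set $$\tau_{\mathcal T}:=\pm\tfrac12\det\big(\mathbf A\Delta_{z''}+\mathbf B\Delta_z^{-1}\big)\,z^{f''}z''^{-f}\;\in\;E_M/\{\pm1\},$$ where $\Delta_z=\mathrm{diag}(z_1,\dots,z_N)$, $\Delta_{z''}=\mathrm{diag}(z_1'',\dots,z_N'')$ and $z^{f''}z''^{-f}=\prod_{i=1}^N z_i^{f_i''}(z_i'')^{-f_i}$. Then $\tau_{\mathcal T}$ is independent of the quad type of $\mathcal T$, of the chosen (omitted) edge of $\mathcal T$, of the choice of a meridian loop, and of the choice of a combinatorial flattening.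
   Context: All manifolds and ideal triangulations are oriented. Let $\mathcal T=\{\Delta_i\}_{i=1}^N$ be an ideal triangulation of $M$; it has $N$ edges. Quad type and shapes: each $\Delta_i$ carries parameters $Z_i,Z_i',Z_i''$ on its three pairs of opposite edges, in the cyclic order determined by the orientation, with exponentials (shapes) $z_i$, $z_i'=1/(1-z_i)$, $z_i''=1-z_i^{-1}$, $z_i\in\mathbb C\setminus\{0,1\}$, so $z_iz_i'z_i''=-1$ (standard convention: for the ideal tetrahedron with vertices $\infty,0,1,z$ the edges $0\infty,1\infty,z\infty$ carry $z,z',z''$). A quad type is a choice, for each tetrahedron, of the pair of opposite edges labelled by $Z_i$; there are three choices per tetrahedron, related by cyclic permutation of $(Z_i,Z_i',Z_i'')$. Gluing matrices: for $I=1,\dots,N$, $\mathbf G_{Ii},\mathbf G'_{Ii},\mathbf G''_{Ii}$ are the numbers of edges of $\Delta_i$ with parameter $Z_i,Z_i',Z_i''$ respectively that are identified with the $I$-th edge of $\mathcal T$. A meridian loop is an oriented simple closed curve on the boundary torus in the meridian class, in general (normal) position with respect to the induced triangulation of the torus. $\mathbf G_{N+1,i},\mathbf G'_{N+1,i},\mathbf G''_{N+1,i}\in\mathbb Z$ are the signed counts of the dihedral angles with parameters $Z_i,Z_i',Z_i''$ subtended by the loop, with sign $+$ (resp. $-$) if the angle is subtended counterclockwise (resp. clockwise) as viewed from the boundary. Neumann–Zagier matrices: the edge equation of one edge is redundant; omit it (number it $N$). For $i\ne N$ put $\mathbf A_{ij}=\mathbf G_{ij}-\mathbf G'_{ij}$,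 $\mathbf B_{ij}=\mathbf G''_{ij}-\mathbf G'_{ij}$, $\eta_i=2-\sum_j\mathbf G'_{ij}$; and $\mathbf A_{Nj}=\mathbf G_{N+1,j}-\mathbf G'_{N+1,j}$, $\mathbf B_{Nj}=\mathbf G''_{N+1,j}-\mathbf G'_{N+1,j}$, $\eta_N=-\sum_j\mathbf G'_{N+1,j}$. The gluing equations are $\prod_j z_j^{\mathbf A_{ij}}(z_j'')^{\mathbf B_{ij}}=(-1)^{\eta_i}$, $i=1,\dots,N$. $\mathcal T$ is regular if some solution with all $z_i\in\mathbb C\setminus\{0,1\}$ gives, via the developing map, the complete hyperbolic structure (the discrete faithful representation $\rho_0$) of $M$; $z=(z_1,\dots,z_N)$ denotes that solution. Combinatorial flattening: integers $(f_i,f_i',f_i'')\in\mathbb Z^3$, $i=1,\dots,N$, with $f_i+f_i'+f_i''=1$ for all $i$ and $\sum_i(\mathbf G_{Ii}f_i+\mathbf G'_{Ii}f_i'+\mathbf G''_{Ii}f_i'')=2$ for $I=1,\dots,N$ and $=0$ for $I=N+1$. Equivalently, $\mathbf Af+\mathbf Bf''=\eta$ for $f=(f_i)$, $f''=(f_i'')$. An enhanced Neumann–Zagier datum $(z,\mathbf A,\mathbf B,f)$ thus depends on the choices of a quad type, an omitted edge, a meridian loop and a combinatorial flattening. *)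

(* Defs.v *)
From mathcomp Require Import all_boot all_order fingroup perm all_algebra.
From mathcomp Require Import reals complex.

Set Implicit Arguments.
Unset Strict Implicit.
Unset Printing Implicit Defensive.

Import Order.TTheory GRing.Theory Num.Theory.
Local Open Scope ring_scope.

(** * Oriented ideal triangulations

    The manifold M is not a separate object: it is the space obtained from the
    tetrahedra of the triangulation by gluing their faces and deleting the
    vertices, so everything attached to M (fundamental group, boundary torus)
    is read off the combinatorial gluing data. *)

Definition v0 : 'I_4 := @Ordinal 4 0 isT.
Definition v1 : 'I_4 := @Ordinal 4 1 isT.
Definition v2 : 'I_4 := @Ordinal 4 2 isT.
Definition v3 : 'I_4 := @Ordinal 4 3 isT.

(* Tetrahedron [i] has vertices 0, 1, 2, 3, and face [f] is the one opposite to
   vertex [f].  [glue T i f = (j, s)] means that face [f] of [i] is identified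
   with face [s f] of [j], vertex [w != f] of [i] going to vertex [s w] of [j].
   Vertices are labelled so that 1, 2, 3 run counterclockwise when seen from
   vertex 0; every tetrahedron then carries the orientation of M exactly when
   all the gluing permutations are odd. *)
Record ideal_triangulation (N : nat) := IdealTriangulation {
  glue : 'I_N -> 'I_4 -> 'I_N * {perm 'I_4};
  glueK : forall i f,
    glue (glue i f).1 ((glue i f).2 f) = (i, ((glue i f).2)^-1%g);
  glue_neq : forall i f, ((glue i f).1, (glue i f).2 f) <> (i, f);
  glue_odd : forall i f, odd_perm (glue i f).2
}.

(* [(i, a, b)] with [a != b] stands for:
   - the edge [ab] of tetrahedron [i];
   - in the link of the ideal vertices, the corner that this edge cuts out of
     the triangle [(i, a)] (the truncation of [i] at [a]);
   - in that link, the side of the triangle [(i, a)] lying on face [b].  *)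
Definition cell (N : nat) : Type := ('I_N * 'I_4 * 'I_4)%type.

Definition nondegenerate (N : nat) (x : cell N) : bool := x.1.2 != x.2.

Definition edge_step (N : nat) (T : ideal_triangulation N) : rel (cell N) :=
  fun x y =>
    (y == (x.1.1, x.2, x.1.2)) ||
    [exists f : 'I_4, [&& f != x.1.2, f != x.2 &
       y == ((glue T x.1.1 f).1, (glue T x.1.1 f).2 x.1.2,
             (glue T x.1.1 f).2 x.2)]].

Definition same_edge (N : nat) (T : ideal_triangulation N) : rel (cell N) :=
  connect (edge_step T).

Definition link_step (N : nat) (T : ideal_triangulation N) :
    rel ('I_N * 'I_4) :=
  fun x y => [exists f : 'I_4, (f != x.2) &&
    (y == ((glue T x.1 f).1, (glue T x.1 f).2 x.2))].

(* The link of the ideal vertices is a closed oriented triangulated surface with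
   4N triangles, 6N sides and 2E vertices, E being the number of edges of T.
   When connected, it is a torus iff its Euler characteristic 2E - 2N is 0. *)
Definition one_torus_cusp (N : nat) (T : ideal_triangulation N) : Prop :=
  (forall x y, connect (link_step T) x y) /\
  n_comp (edge_step T) (@nondegenerate N) = N.

(** * Curves on the boundary torus *)

(* The side identified with the side [x = (i, v, w)]. *)
Definition side_glue (N : nat) (T : ideal_triangulation N) (x : cell N) :
    cell N :=
  ((glue T x.1.1 x.2).1, (glue T x.1.1 x.2).2 x.1.2,
   (glue T x.1.1 x.2).2 x.2).

(* Cellular 1-chains of the cell structure dual to the triangulation of the
   torus: [c (i, v, w)] is the algebraic number of times that the chain leaves
   the triangle [(i, v)] through its side on face [w]. *)
Definition chain (N : nat) : Type := cell N -> int.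

Definition is_cycle (N : nat) (T : ideal_triangulation N) (c : chain N) :
    Prop :=
  (forall x, nondegenerate x -> c (side_glue T x) = - c x) /\
  (forall i v, \sum_(w : 'I_4 | w != v) c (i, v, w) = 0).

(* The dual 2-cells correspond to the vertices of the triangulated torus, i.e.
   to the classes of corners; [u] is a 2-chain, and the right-hand side of the
   last equation is its boundary when 2-cells are oriented counterclockwise. *)
Definition homologous (N : nat) (T : ideal_triangulation N) (c d : chain N) :
    Prop :=
  exists u : cell N -> int,
    (forall i v w f, v != w -> f != v -> f != w ->
       u ((glue T i f).1, (glue T i f).2 v, (glue T i f).2 w) = u (i, v, w)) /\
    (forall i (t : {perm 'I_4}), ~~ odd_perm t ->
       c (i, t v0, t v1) - d (i, t v0, t v1) =
       u (i, t v0, t v3) - u (i, t v0, t v2)).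

Definition null_homologous (N : nat) (T : ideal_triangulation N) (c : chain N) :
    Prop :=
  homologous T c (fun=> 0).

(* The chain of a closed curve, given the list of the sides it crosses, each
   described from the triangle that the curve leaves. *)
Definition crossing_chain (N : nat) (T : ideal_triangulation N)
    (l : seq (cell N)) : chain N :=
  fun x => (count_mem x l)%:Z - (count_mem (side_glue T x) l)%:Z.

(* A directed arc [(i, t, k)] of a normal curve lies in the triangle
   [(i, t v0)], enters it through the side on face [t v1], leaves it through the
   side on face [t v2], and so cuts off the corner at the edge joining [t v0] to
   [t v3].  Its depth [k] is the number of arcs of the curve lying between it
   and that corner. *)
Definition arc (N : nat) : Type := ('I_N * {perm 'I_4} * nat)%type.

Definition arc_tet (N : nat) (x : arc N) : 'I_N := x.1.1.
Definition arc_perm (N : nat) (x : arc N) : {perm 'I_4} := x.1.2.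
Definition arc_depth (N : nat) (x : arc N) : nat := x.2.

Definition arc_corner (N : nat) (x : arc N) : cell N :=
  (arc_tet x, arc_perm x v0, arc_perm x v3).

Definition arc_exit (N : nat) (x : arc N) : cell N :=
  (arc_tet x, arc_perm x v0, arc_perm x v2).

(* +1 if the arc turns counterclockwise around its corner as seen from the ideal
   vertex, -1 otherwise. *)
Definition arc_sign (N : nat) (x : arc N) : int :=
  if odd_perm (arc_perm x) then 1 else -1.

Definition arcs_at (N : nat) (p : seq (arc N)) (c : cell N) : nat :=
  count (fun x => arc_corner x == c) p.

(* The arc [y] starts at the point where [x] ends.  That point is the
   [arc_depth x]-th one (from 0) on the exit side of [x], counting from the
   corner of [x].  If [y] cuts off the other end of this side, the points are
   counted from that end by [arc_depth y]. *)
Definition arc_next (N : nat) (T : ideal_triangulation N) (p : seq (arc N)) :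
    rel (arc N) :=
  fun x y =>
    let s := arc_perm x in let t := arc_perm y in
    let g := (glue T (arc_tet x) (s v2)).2 in
    [&& arc_tet y == (glue T (arc_tet x) (s v2)).1,
        t v0 == g (s v0), t v1 == g (s v2) &
        if t v3 == g (s v3) then arc_depth y == arc_depth x
        else (arc_depth x + arc_depth y).+1 ==
             (arcs_at p (arc_tet y, t v0, t v3) +
              arcs_at p (arc_tet y, t v0, t v2))%N].

(* Normal oriented simple closed curves: the depths of the arcs at each corner
   being 0, 1, ..., m - 1, the arcs can be drawn pairwise disjoint. *)
Definition simple_closed_curve (N : nat) (T : ideal_triangulation N)
    (p : seq (arc N)) : Prop :=
  path.cycle (arc_next T p) p /\
  (forall c : cell N,
     perm_eq [seq arc_depth x | x <- p & arc_corner x == c]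
             (iota 0 (arcs_at p c))).

Definition curve_chain (N : nat) (T : ideal_triangulation N)
    (p : seq (arc N)) : chain N :=
  crossing_chain T [seq arc_exit x | x <- p].

(* A meridian class, i.e. a nonzero class in the first homology group of the
   torus, is represented by a cycle [mu]. *)
Definition meridian_class (N : nat) (T : ideal_triangulation N)
    (mu : chain N) : Prop :=
  is_cycle T mu /\ ~ null_homologous T mu.

Definition meridian_loop (N : nat) (T : ideal_triangulation N) (mu : chain N)
    (p : seq (arc N)) : Prop :=
  simple_closed_curve T p /\ homologous T (curve_chain T p) mu.

(** * The fundamental group of M and its peripheral subgroup *)

(* A walk in the dual graph of T is the list of the faces it crosses, each
   numbered in the tetrahedron that the walk leaves. *)
Definition walk_end (N : nat) (T : ideal_triangulation N) (i : 'I_N)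
    (s : seq 'I_4) : 'I_N :=
  foldl (fun j f => (glue T j f).1) i s.

(* Turning around the edge [t v0, t v1] of [i]: leave through face [t v2]. *)
Definition turn (N : nat) (T : ideal_triangulation N)
    (x : 'I_N * {perm 'I_4}) : 'I_N * {perm 'I_4} :=
  ((glue T x.1 (x.2 v2)).1,
   (tperm v2 v3 * x.2 * (glue T x.1 (x.2 v2)).2)%g).

Definition edge_loop (N : nat) (T : ideal_triangulation N) (i : 'I_N)
    (t : {perm 'I_4}) : seq 'I_4 :=
  [seq (x.2 : {perm 'I_4}) v2 | x <- orbit (turn T) (i, t)].

(* Homotopy with fixed endpoints in the 2-complex dual to T, which is a
   deformation retract of M: one 2-cell for each edge of T. *)
Inductive homotopic (N : nat) (T : ideal_triangulation N) (i : 'I_N) :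
    seq 'I_4 -> seq 'I_4 -> Prop :=
| homotopic_refl s : homotopic T i s s
| homotopic_sym s s' : homotopic T i s s' -> homotopic T i s' s
| homotopic_trans s s' s'' :
    homotopic T i s s' -> homotopic T i s' s'' -> homotopic T i s s''
| homotopic_backtrack s s' f :
    homotopic T i (s ++ s')
      (s ++ [:: f; (glue T (walk_end T i s) f).2 f] ++ s')
| homotopic_edge s s' t :
    homotopic T i (s ++ s') (s ++ edge_loop T (walk_end T i s) t ++ s').

(* Walks from triangle to triangle in the torus, by the sides they cross. *)
Fixpoint link_sides (N : nat) (T : ideal_triangulation N) (i : 'I_N) (v : 'I_4)
    (s : seq 'I_4) : seq (cell N) :=
  if s is w :: s' then
    (i, v, w) :: link_sides T (glue T i w).1 ((glue T i w).2 v) s'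
  else [::].

Definition link_walk_end (N : nat) (T : ideal_triangulation N) (x : 'I_N * 'I_4)
    (s : seq 'I_4) : 'I_N * 'I_4 :=
  foldl (fun y w => ((glue T y.1 w).1, (glue T y.1 w).2 y.2)) x s.

Definition closed_link_walk (N : nat) (T : ideal_triangulation N) (i : 'I_N)
    (v : 'I_4) (s : seq 'I_4) : Prop :=
  all (@nondegenerate N) (link_sides T i v s) /\
  link_walk_end T (i, v) s = (i, v).

(** * Shapes, developing map and holonomy *)

Section Shapes.
Variables (R : realType) (N : nat) (T : ideal_triangulation N).
Implicit Types (z : 'I_N -> R[i]) (g h : 'M[R[i]]_2).

(* The three pairs of opposite edges of a tetrahedron, in the cyclic order given
   by the orientation: 0 for 01 and 23, 1 for 02 and 13, 2 for 03 and 12. *)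
Definition edge_type (a b : 'I_4) : 'I_3 :=
  inord (if a == v0 then b.-1 else if b == v0 then a.-1 else 5 - (a + b))%N.

(* w, w' and w'' for k = 0, 1 and 2. *)
Definition shape (w : R[i]) (k : 'I_3) : R[i] :=
  match val k with
  | 0%N => w
  | 1%N => (1 - w)^-1
  | _ => 1 - w^-1
  end.

(* In [z], the shape [z i] is the one of the edges 01 and 23 of tetrahedron
   [i]. *)
Definition edge_equations z : Prop :=
  forall x : cell N, nondegenerate x ->
    \prod_(y : cell N | (y.1.2 < y.2)%N && same_edge T x y)
       shape (z y.1.1) (edge_type y.1.2 y.2) = 1.

(* Homogeneous coordinates of the vertices oo, 0, 1, w. *)
Definition ideal_vertex (w : R[i]) (v : 'I_4) : 'cV[R[i]]_2 :=
  match val v with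
  | 0%N => \col_(r < 2) (if r == 0 then 1 else 0)
  | 1%N => \col_(r < 2) (if r == 0 then 0 else 1)
  | 2%N => \col_(r < 2) 1
  | _ => \col_(r < 2) (if r == 0 then w else 1)
  end.

(* A lift to SL_2(C) of the Moebius transformation which moves the standard copy
   (oo, 0, 1, z j) of the tetrahedron [j] across face [f] of the standard copy
   of [i], so that the two copies match along that face. *)
Definition face_pairing z (i : 'I_N) (f : 'I_4) g : Prop :=
  \det g = 1 /\
  forall w : 'I_4, w != f -> exists c : R[i],
    g *m ideal_vertex (z (glue T i f).1) ((glue T i f).2 w) =
    c *: ideal_vertex (z i) w.

(* Developing along the walk [s] from the standard copy of [i], one ends at the
   image by [g] of the standard copy of the final tetrahedron.  The matrix [g]
   of determinant 1 is determined up to sign. *)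
Fixpoint holonomy z (i : 'I_N) (s : seq 'I_4) g : Prop :=
  if s is f :: s' then
    exists g1 g2, [/\ face_pairing z i f g1,
      holonomy z (glue T i f).1 s' g2 & g = g1 *m g2]
  else g = 1%:M.

Definition parabolic g : Prop :=
  [/\ (\tr g) ^+ 2 = 4%:R, g <> 1%:M & g <> - 1%:M].

(* [g] is a lift to SL_2(C) of an element of the image of the holonomy
   representation of the fundamental group based at [i]. *)
Definition holonomy_group z (i : 'I_N) g : Prop :=
  exists s, walk_end T i s = i /\ holonomy z i s g.

(* The shapes [z] define, through the developing map, the complete hyperbolic
   structure: the edge equations hold, so that the holonomy is a representation
   of the fundamental group; it is faithful, with discrete image; and the end of
   M is a cusp, whose torus group is embedded as a group of parabolics.  As M
   has Euler characteristic 0, this structure has finite volume. *)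
Definition complete_hyperbolic z (i : 'I_N) : Prop :=
  [/\ (forall j, z j != 0 /\ z j != 1),
      edge_equations z,
      (forall s g, walk_end T i s = i -> holonomy z i s g ->
         g = 1%:M \/ g = - 1%:M -> homotopic T i s [::]),
      (exists2 e : R[i], 0 < e & forall g, holonomy_group z i g ->
         (forall a b, `|g a b - (1%:M : 'M[R[i]]_2) a b| < e) -> g = 1%:M) &
      (forall j v s g, closed_link_walk T j v s ->
         ~ null_homologous T (crossing_chain T (link_sides T j v s)) ->
         holonomy z j s g -> parabolic g)].

(* Products of squares of elements of [P]; when [P] is a group, the subgroup
   generated by the squares. *)
Inductive squares (P : 'M[R[i]]_2 -> Prop) : 'M[R[i]]_2 -> Prop :=
| squares_one : squares P 1%:M
| squares_mul g h : P g -> squares P h -> squares P (g *m g *m h).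

Inductive generated_field (S : R[i] -> Prop) : R[i] -> Prop :=
| generated_in x : S x -> generated_field S x
| generated_one : generated_field S 1
| generated_sub x y :
    generated_field S x -> generated_field S y -> generated_field S (x - y)
| generated_mul x y :
    generated_field S x -> generated_field S y -> generated_field S (x * y)
| generated_inv x : generated_field S x -> generated_field S x^-1.

(* E_M, the field generated over Q by the traces of the group generated by the
   squares of the elements of the image of the holonomy representation. *)
Definition invariant_trace_field z (i : 'I_N) : R[i] -> Prop :=
  generated_field
    (fun x => exists2 g, squares (holonomy_group z i) g & x = \tr g).

End Shapes.

(** * Enhanced Neumann-Zagier data *)

Section NeumannZagier.
Variables (n : nat) (T : ideal_triangulation n.+1).
Local Notation N := n.+1.

(* A numbering of the N edges of T. *)
Definition edge_numbering (e : cell N -> 'I_N) : Prop :=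
  (forall x y, nondegenerate x -> nondegenerate y ->
     (e x == e y) = same_edge T x y) /\
  (forall k, exists2 x, nondegenerate x & e x = k).

(* The quad type [q] labels by Z the edges of type [q i] of tetrahedron [i]; the
   parameters Z, Z', Z'' of the cyclic order are then on the edges of types
   [q i + k] (modulo 3) for k = 0, 1, 2. *)
Definition edge_gluing (q : 'I_N -> 'I_3) (e : cell N -> 'I_N) (k : 'I_3)
    (r i : 'I_N) : int :=
  (#|[set ab : 'I_4 * 'I_4 | [&& (ab.1 < ab.2)%N,
      edge_type ab.1 ab.2 == q i + k & e (i, ab.1, ab.2) == r]]|)%:Z.

Definition loop_gluing (q : 'I_N -> 'I_3) (p : seq (arc N)) (k : 'I_3)
    (i : 'I_N) : int :=
  \sum_(x <- p | (arc_tet x == i) &&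
       (edge_type (arc_perm x v0) (arc_perm x v3) == q i + k)) arc_sign x.

Record combinatorial_flattening (q : 'I_N -> 'I_3) (e : cell N -> 'I_N)
    (p : seq (arc N)) (f : 'I_3 -> 'I_N -> int) : Prop := {
  flattening_tet : forall i, \sum_k f k i = 1;
  flattening_edge : forall r, \sum_i \sum_k edge_gluing q e k r i * f k i = 2;
  flattening_loop : \sum_i \sum_k loop_gluing q p k i * f k i = 0
}.

(* The omitted edge is the one numbered [ord_max]; a choice of omitted edge is
   part of the choice of the numbering.  The flattening integers f, f', f'' are
   [nz_flat 0], [nz_flat 1] and [nz_flat 2]. *)
Record enhanced_NZ_datum (mu : chain N) := EnhancedNZDatum {
  nz_quad : 'I_N -> 'I_3;
  nz_edge : cell N -> 'I_N;
  nz_loop : seq (arc N);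
  nz_flat : 'I_3 -> 'I_N -> int;
  nz_edgeP : edge_numbering nz_edge;
  nz_loopP : meridian_loop T mu nz_loop;
  nz_flatP : combinatorial_flattening nz_quad nz_edge nz_loop nz_flat
}.

Section Datum.
Variables (mu : chain N) (D : enhanced_NZ_datum mu).

(* Rows r < n of G, G', G'' (k = 0, 1, 2) are those of the edges that are kept,
   the last row is that of the meridian loop. *)
Definition nz_gluing (k : 'I_3) : 'M[int]_N :=
  \matrix_(r, i) (if r == ord_max then loop_gluing (nz_quad D) (nz_loop D) k i
                  else edge_gluing (nz_quad D) (nz_edge D) k r i).

Definition nz_A : 'M[int]_N := nz_gluing 0 - nz_gluing 1.
Definition nz_B : 'M[int]_N := nz_gluing 2%:R - nz_gluing 1.

Variables (R : realType) (z : 'I_N -> R[i]).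

(* The shapes z_i and z_i'' for the quad type of the datum. *)
Definition nz_z (i : 'I_N) : R[i] := shape (z i) (nz_quad D i).
Definition nz_z'' (i : 'I_N) : R[i] := shape (z i) (nz_quad D i + 2%:R).

(* A representative of tau in C; the exponents are integers. *)
Definition tau : R[i] :=
  2%:R^-1 *
  \det (map_mx intr nz_A *m diag_mx (\row_i nz_z'' i) +
        map_mx intr nz_B *m invmx (diag_mx (\row_i nz_z i))) *
  \prod_i (nz_z i ^ nz_flat D 2%:R i * nz_z'' i ^ (- nz_flat D 0 i)).

End Datum.
End NeumannZagier.

(* Main.v *)
Require Import Defs.
From mathcomp Require Import all_boot all_order fingroup perm all_algebra.
From mathcomp Require Import reals complex.
From mathcomp Require Import ring.
From mathcomp Require boolp.
(* The names arc and nondegenerate also exist in the libraries above; the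
   second import restores the meaning they have for triangulations. *)
Require Import Defs.
Import GRing.Theory Num.Theory.
Local Open Scope ring_scope.

(** Why the theorem holds.

    For a shape w put kappa_0 = 1 - w, kappa_1 = w and kappa_2 = -1, with
    indices modulo 3.  These numbers add up to 0, and the shape of the edges of
    type k is - kappa_(k+1) / kappa_(k+2).  Hence, whatever the quad type q,
    the column of A Delta_z'' + B Delta_z^-1 belonging to a tetrahedron is
    - 1 / kappa_(q+1) times its column of W = sum_t G^t kappa_t, where G^t
    counts the edges of absolute type t; and z^f'' z''^-f is, up to sign, the
    product over the tetrahedra of kappa_(q+1) prod_t kappa_t^(-f_t), because
    the three integers f_t of a tetrahedron add up to 1.  So the quad type
    disappears from
      tau^2 = 1/4 (det W)^2 prod_i prod_t kappa_t(i)^(-2 f_t(i)),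
    which is [tau_sq].  As tau only matters up to sign, everything below is
    about squares.

    The determinant. The N edge rows of W add up to 0, since every tetrahedron
    has two edges of each type; so leaving out one edge or another makes no
    difference.  The loop row is a linear function of the chain of sides that
    the loop crosses ([loop_weight]), and this function turns the boundary of a
    2-chain into an integral combination of edge rows ([boundary_weight]).
    Therefore any two matrices W have rows that are integral combinations of the
    rows of each other, and their determinants agree up to sign
    ([det_int_comb]).

    The flattening.  Represent the ideal vertices of the developed tetrahedra
    by vectors in C^2.  A closed curve on the cusp torus acts on the vector of
    the ideal vertex it encircles by an eigenvalue of a parabolic element of
    SL_2(C), that is by 1 or -1.  Hence the vectors can be scaled so as to be
    equivariant up to sign, and the squares of their 2x2 determinants give a
    number h_E for each edge E of the triangulation ([edge_lengths]): these are
    Ptolemy coordinates, squared.  By the cross-ratio formula, kappa_t(i)^2 is,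
    up to a factor depending on i only, the product of h over the two edges of
    type t of tetrahedron i.  If f and f' are two flattenings, then
    prod_i prod_t kappa_t(i)^(2 (f_t - f'_t)) is the product over E of h_E to
    the power sum of f - f' around E, which is 2 - 2 = 0.

    Completeness speaks of curves that are not null-homologous.  One such curve
    comes from the meridian loop of the datum; it can be moved to any triangle
    of the connected torus ([essential_at]), and appending it to a
    null-homologous curve shows that the latter has eigenvalue 1 or -1 as well
    ([closed_multiplier]).

    The trace field.  These curves also give, at each vertex v of a tetrahedron,
    a parabolic g_v in the holonomy group.  Traces of products of the
    n_v = g_v^2 - 1 lie in the invariant trace field, n_v is a multiple of the
    nilpotent matrix determined by the vector of v, and
      z = tr (n_0 n_2 n_1 n_3) / (tr (n_0 n_3) tr (n_1 n_2)).
    So all shapes lie in that field ([shape_mem]), and tau with them. *)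

Set Implicit Arguments.
Unset Strict Implicit.
Unset Printing Implicit Defensive.

(** * Edge types of an oriented tetrahedron *)

Lemma ord2P (r : 'I_2) : r = 0 \/ r = 1.
Proof. by case: r => [[|[|//]] ?]; [left|right]; apply: val_inj. Qed.

Lemma ord3P (k : 'I_3) : [\/ k = 0, k = 1 | k = 2%:R].
Proof.
by case: k => [[|[|[|//]]] ?]; [apply: Or31|apply: Or32|apply: Or33];
  apply: val_inj.
Qed.

Lemma ord4P (v : 'I_4) : [\/ v = v0, v = v1, v = v2 | v = v3].
Proof.
by case: v => [[|[|[|[|//]]]] ?];
  [apply: Or41|apply: Or42|apply: Or43|apply: Or44]; apply: val_inj.
Qed.

Lemma big_ord3 (V : Type) (idx : V) (op : Monoid.law idx) (F : 'I_3 -> V) :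
  \big[op/idx]_k F k = op (F 0) (op (F 1) (F 2%:R)).
Proof.
rewrite !big_ord_recl big_ord0 Monoid.mulm1.
by congr (op (F _) (op (F _) (F _))); apply: val_inj.
Qed.

Lemma big_ord4 (V : Type) (idx : V) (op : Monoid.law idx) (F : 'I_4 -> V) :
  \big[op/idx]_v F v = op (F v0) (op (F v1) (op (F v2) (F v3))).
Proof.
rewrite !big_ord_recl big_ord0 Monoid.mulm1.
by congr (op (F _) (op (F _) (op (F _) (F _)))); apply: val_inj.
Qed.

Lemma mod3_addE (k : 'I_3) :
  ((k + 1 + 1 = k + 2%:R)%R * (k + 1 + 2%:R = k)%R * (k + 2%:R + 1 = k)%R *
   (k + 2%:R + 2%:R = k + 1)%R)%type.
Proof.
have three : 1 + 2%:R = 0 :> 'I_3 by apply: val_inj.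
do !split; rewrite -addrA ?[2%:R + 1]addrC ?three ?addr0 //.
by congr (_ + _); apply: val_inj.
Qed.

Lemma edge_typeC a b : a != b -> edge_type a b = edge_type b a.
Proof.
by case: a b => [[|[|[|[|//]]]] ?] [[|[|[|[|//]]]] ?] // _;
  rewrite /edge_type /=.
Qed.

Lemma edge_type_tperm (x0 x1 x2 a b : 'I_4) (odd : bool) :
  x0 != x1 -> x0 != x2 -> x1 != x2 -> a != b ->
  edge_type x0 x2 = edge_type x0 x1 + (if odd then 2%:R else 1) ->
  edge_type (tperm a b x0) (tperm a b x2) =
    edge_type (tperm a b x0) (tperm a b x1) + (if ~~ odd then 2%:R else 1).
Proof.
have E (x y u : 'I_3) : (x == y + u) = (val x == (val y + val u) %% 3)%N by [].
move=> x01 x02 x12 ab /eqP; rewrite E => h; apply/eqP; rewrite E !permE.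
move: x01 x02 x12 ab h; rewrite /edge_type.
case: x0 => [[|[|[|[|//]]]] ?]; case: x1 => [[|[|[|[|//]]]] ?]; try by [];
case: x2 => [[|[|[|[|//]]]] ?]; try by []; case: odd; rewrite /= ?inordK //=;
by case: a => [[|[|[|[|//]]]] ?]; case: b => [[|[|[|[|//]]]] ?] //=;
  rewrite ?inordK.
Qed.

(** Seen from the vertex t v0, the three edges t v1, t v2, t v3 have types in
    cyclic order exactly when t preserves the orientation.  A transposition
    reverses both the orientation and the cyclic order of the types, and
    transpositions generate. *)
Lemma edge_type_perm (t : {perm 'I_4}) :
  edge_type (t v0) (t v2) =
    edge_type (t v0) (t v1) + (if odd_perm t then 2%:R else 1).
Proof.
have [ts -> /allP dts] := prod_tpermP t.
elim/last_ind: ts dts => [|ts [a b] IH] dts.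
  rewrite big_nil odd_perm1 !perm1; apply/eqP; rewrite -val_eqE /edge_type /=.
  by rewrite !inordK.
have dab : a != b by apply: (dts (a, b)); rewrite mem_rcons mem_head.
rewrite -cats1 big_cat big_seq1 /= odd_permM odd_tperm dab addbT !permM.
apply: edge_type_tperm; rewrite ?(inj_eq perm_inj) //.
by apply: IH => x xts; apply: dts; rewrite mem_rcons inE xts orbT.
Qed.

Lemma edge_type_perm3 (t : {perm 'I_4}) :
  edge_type (t v0) (t v3) =
    edge_type (t v0) (t v1) + (if odd_perm t then 1 else 2%:R).
Proof.
have := edge_type_perm (tperm v2 v3 * t); rewrite odd_permM odd_tperm !permM.
by rewrite tpermL !tpermD //= => ->; case: (odd_perm t).
Qed.

Lemma big_edge_type (V : Type) (idx : V) (op : Monoid.com_law idx)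
    (F : 'I_4 -> 'I_4 -> V) k :
  \big[op/idx]_(ab : 'I_4 * 'I_4 | (ab.1 < ab.2)%N &&
     (edge_type ab.1 ab.2 == k)) F ab.1 ab.2 =
  match val k with
  | 0%N => op (F v0 v1) (F v2 v3)
  | 1%N => op (F v0 v2) (F v1 v3)
  | _ => op (F v0 v3) (F v1 v2)
  end.
Proof.
rewrite big_mkcond -(pair_bigA _ (fun a b : 'I_4 =>
  if (a < b)%N && (edge_type a b == k) then F a b else idx)) /=.
rewrite !big_ord4 /= !(Monoid.mul1m, Monoid.mulm1).
rewrite -!val_eqE /edge_type /= !inordK //.
by case: k => [[|[|[|//]]] ?] /=; rewrite !(Monoid.mul1m, Monoid.mulm1).
Qed.

Lemma sum_edge_types (V : nmodType) (F : 'I_3 -> V) :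
  \sum_(ab : 'I_4 * 'I_4 | (ab.1 < ab.2)%N) F (edge_type ab.1 ab.2) =
  \sum_k (F k + F k).
Proof.
rewrite (partition_big (fun ab : 'I_4 * 'I_4 => edge_type ab.1 ab.2) xpredT) //=.
apply: eq_bigr => k _.
transitivity (\sum_(ab : 'I_4 * 'I_4 | (ab.1 < ab.2)%N &&
  (edge_type ab.1 ab.2 == k)) F k); first by apply: eq_bigr => ab /andP[_ /eqP->].
by rewrite (big_edge_type _ (fun _ _ => F k)); case: k => [[|[|[|//]]] ?].
Qed.

Lemma sum_neq_perm (V : nmodType) (t : {perm 'I_4}) (F : 'I_4 -> V) :
  \sum_(w | t v0 != w) F w = F (t v1) + F (t v2) + F (t v3).
Proof.
rewrite (reindex_inj (@perm_inj _ t)) /= big_mkcond big_ord4.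
by rewrite !(inj_eq perm_inj) /= add0r addrA.
Qed.

Lemma sum_neq_pairs (V : nmodType) (F : 'I_4 -> 'I_4 -> V) :
  \sum_v \sum_(w | v != w) F v w =
  \sum_(ab : 'I_4 * 'I_4 | (ab.1 < ab.2)%N) (F ab.1 ab.2 + F ab.2 ab.1).
Proof.
rewrite pair_big_dep /= big_split /=.
rewrite (bigID (fun ab : 'I_4 * 'I_4 => (ab.1 < ab.2)%N)) /=; congr (_ + _).
  by apply: eq_bigl => -[a b] /=; rewrite -val_eqE /=; case: ltngtP.
rewrite (reindex_inj (inv_inj swap_pairK)) /=.
by apply: eq_bigl => -[a b] /=; rewrite -val_eqE /=; case: ltngtP.
Qed.

Lemma even_perm_at (v : 'I_4) :
  exists2 t : {perm 'I_4}, t v0 = v & ~~ odd_perm t.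
Proof.
case s_odd : (odd_perm (tperm v0 v)); last first.
  by exists (tperm v0 v); rewrite ?tpermL ?s_odd.
exists (tperm v1 v2 * tperm v0 v)%g.
  by rewrite permM (tpermD (z := v0)) ?tpermL.
by rewrite odd_permM (odd_tperm v1) s_odd.
Qed.

(** * Weights of curves on the cusp torus *)

Section SideWeights.
Variables (V : pzRingType) (psi : 'I_3 -> V).
Hypothesis psi0 : \sum_k psi k = 0.

(** A primitive of psi: the corners of a link triangle carry psi, its sides,
    labelled by the type of the opposite corner, carry [side_weight], and going
    around a corner changes the side weight by psi of that corner. *)
Definition side_weight (k : 'I_3) : V :=
  match val k with 0%N => - psi 1 | 1%N => psi 0 | _ => 0 end.

Lemma side_weightE k : psi k = side_weight (k + 1) - side_weight (k + 2%:R).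
Proof.
have e2 : psi 2%:R = - psi 1 - psi 0.
  have := psi0; rewrite big_ord3 /= addrA addrC => /eqP.
  by rewrite addr_eq0 opprD addrC => /eqP.
have [->|->|->] := ord3P k.
- by rewrite /side_weight /= subr0.
- by rewrite /side_weight /= opprK add0r.
- by rewrite e2.
Qed.

End SideWeights.

Section SideGluing.
Variables (N : nat) (T : ideal_triangulation N).

Lemma side_glueK : involutive (side_glue T).
Proof. by move=> [[i v] w]; rewrite /side_glue /= glueK /= !permK. Qed.

Lemma sum_crossing_chain (V : pzRingType) (l : seq (cell N)) (F : cell N -> V) :
  \sum_(x <- l) (F x - F (side_glue T x)) =
  \sum_x (crossing_chain T l x)%:~R * F x.
Proof.
have E (G : cell N -> V) : \sum_(x <- l) G x = \sum_x (count_mem x l)%:R * G x.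
  elim: l => [|y l IH]; first by rewrite big_nil big1 // => x _; rewrite mul0r.
  rewrite big_cons IH.
  under [RHS]eq_bigr do rewrite /= natrD mulrDl.
  rewrite big_split /=; congr (_ + _).
  rewrite (bigD1 y) //= eqxx mul1r big1 ?addr0 // => x /negPf xy.
  by rewrite eq_sym xy mul0r.
rewrite sumrB !E [X in _ - X](reindex_inj (inv_inj side_glueK)) /= -sumrB.
by apply: eq_bigr => x _; rewrite side_glueK /crossing_chain intrB mulrBl.
Qed.

End SideGluing.

Section CurveWeights.
Variables (N : nat) (T : ideal_triangulation N).
Variables (V : comPzRingType) (psi : 'I_N -> 'I_3 -> V).
Hypothesis psi0 : forall i, \sum_k psi i k = 0.

Definition corner_weight (x : cell N) : V := psi x.1.1 (edge_type x.1.2 x.2).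

Definition cell_side_weight (x : cell N) : V :=
  side_weight (psi x.1.1) (edge_type x.1.2 x.2).

Definition arc_entry (x : arc N) : cell N :=
  (arc_tet x, arc_perm x v0, arc_perm x v1).

Lemma arc_exit_nondegenerate (x : arc N) : nondegenerate (arc_exit x).
Proof. by rewrite /nondegenerate /= (inj_eq perm_inj). Qed.

Lemma arc_weight x :
  (arc_sign x)%:~R * corner_weight (arc_corner x) =
  cell_side_weight (arc_exit x) - cell_side_weight (arc_entry x).
Proof.
rewrite /corner_weight /cell_side_weight /arc_sign /=.
rewrite edge_type_perm3 edge_type_perm side_weightE //.
case: (odd_perm _); first by rewrite mul1r !mod3_addE.
by rewrite !mod3_addE mulrN1z mulN1r opprB.
Qed.

Lemma arc_next_entry p x y :
  arc_next T p x y -> arc_entry y = side_glue T (arc_exit x).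
Proof.
case/and4P=> /eqP e1 /eqP e2 /eqP e3 _.
by rewrite /arc_entry /side_glue /= e1 e2 e3.
Qed.

Lemma sum_cycle (A : Type) (e : rel A) (G H : A -> V) p :
  (forall x y, e x y -> G y = H x) -> path.cycle e p ->
  \sum_(x <- p) G x = \sum_(x <- p) H x.
Proof.
move=> eGH; case: p => [_|x p]; first by rewrite !big_nil.
have E y q : path e y q -> \sum_(a <- q) G a = \sum_(a <- belast y q) H a.
  elim: q y => [|a q IH] y /=; first by rewrite !big_nil.
  by case/andP=> /eGH ya /IH q'; rewrite !big_cons ya q'.
move=> /= /E; rewrite belast_rcons => <-.
by rewrite -cats1 big_cat big_seq1 big_cons addrC.
Qed.

Lemma sum_cells_at (W : nmodType) i (F : cell N -> W) :
  \sum_(x : cell N | (x.1.1 == i) && nondegenerate x) F x =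
  \sum_v \sum_(w | v != w) F (i, v, w).
Proof.
rewrite pair_big_dep /=.
rewrite (reindex_onto (fun y : 'I_4 * 'I_4 => (i, y.1, y.2))
                      (fun x => (x.1.2, x.2))) /=.
  by apply: eq_bigl => -[v w]; rewrite /nondegenerate /= !eqxx !andbT.
by move=> [[j v] w] /= /andP[/eqP->].
Qed.

(** The corners turned around by a closed curve depend on more than its chain,
    but their total weight does not: each arc contributes the difference of
    the weights of the sides through which it leaves and enters. *)
Lemma loop_weight p i : path.cycle (arc_next T p) p ->
  \sum_(x <- p | arc_tet x == i)
     (arc_sign x)%:~R * corner_weight (arc_corner x) =
  \sum_(x : cell N | (x.1.1 == i) && nondegenerate x)
     (curve_chain T p x)%:~R * cell_side_weight x.
Proof.
move=> p_cyc.
pose F x := if (x.1.1 == i) && nondegenerate x then cell_side_weight x else 0.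
transitivity (\sum_(x <- p) F (arc_exit x) - \sum_(x <- p) F (arc_entry x)).
  rewrite big_mkcond -sumrB; apply: eq_bigr => x _; rewrite /F /=.
  rewrite !(arc_exit_nondegenerate, andbT) /nondegenerate /= (inj_eq perm_inj).
  by rewrite andbT; case: eqP; rewrite ?subrr // arc_weight.
rewrite (sum_cycle (G := F \o arc_entry)
           (H := F \o (side_glue T \o @arc_exit N)) _ p_cyc); last first.
  by move=> x y /arc_next_entry /= ->.
rewrite -sumrB.
rewrite -(big_map (@arc_exit N) xpredT (fun x => F x - F (side_glue T x))).
rewrite sum_crossing_chain [in RHS]big_mkcond; apply: eq_bigr => x _ /=.
by rewrite /F; case: ifP; rewrite ?mulr0.
Qed.

(** Summation by parts in each triangle of the link: the boundary of the
    2-chain u pairs with the side weights as u pairs with their differences,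
    the corner weights. *)
Lemma boundary_weight (b u : cell N -> int) i :
  (forall t : {perm 'I_4}, ~~ odd_perm t ->
     b (i, t v0, t v1) = u (i, t v0, t v3) - u (i, t v0, t v2)) ->
  \sum_(x : cell N | (x.1.1 == i) && nondegenerate x)
     (b x)%:~R * cell_side_weight x =
  \sum_(x : cell N | (x.1.1 == i) && nondegenerate x)
     (u x)%:~R * corner_weight x.
Proof.
move=> bu; rewrite !sum_cells_at; apply: eq_bigr => v _.
have [t <- te] := even_perm_at v; rewrite !sum_neq_perm.
have b1 := bu _ te.
have b2 : b (i, t v0, t v2) = u (i, t v0, t v1) - u (i, t v0, t v3).
  have := bu (tperm v1 v2 * tperm v1 v3 * t)%g.
  by rewrite !odd_permM !odd_tperm !permM !permE /= => /(_ te).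
have b3 : b (i, t v0, t v3) = u (i, t v0, t v2) - u (i, t v0, t v1).
  have := bu (tperm v1 v3 * tperm v1 v2 * t)%g.
  by rewrite !odd_permM !odd_tperm !permM !permE /= => /(_ te).
rewrite b1 b2 b3 /corner_weight /cell_side_weight /=.
rewrite edge_type_perm3 edge_type_perm (negPf te) !(side_weightE (psi0 i)).
by rewrite !mod3_addE; ring.
Qed.

End CurveWeights.

(** * The determinant *)

Section IntegerCombinations.
Variables (K : numFieldType) (n : nat).
Implicit Types (M : 'M[K]_n) (v : 'rV[K]_n).

Definition int_comb M v : Prop := exists c : 'rV[int]_n, v = map_mx intr c *m M.

Lemma int_comb_row M r : int_comb M (row r M).
Proof. by exists (delta_mx 0 r); rewrite map_delta_mx -rowE. Qed.

Lemma int_combD M v w : int_comb M v -> int_comb M w -> int_comb M (v + w).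
Proof. by move=> [c ->] [d ->]; exists (c + d); rewrite map_mxD mulmxDl. Qed.

Lemma int_combZ M v (a : int) : int_comb M v -> int_comb M (a%:~R *: v).
Proof. by move=> [c ->]; exists (a *: c); rewrite map_mxZ scalemxAl. Qed.

Lemma int_combN M v : int_comb M v -> int_comb M (- v).
Proof. by move/(int_combZ (-1)); rewrite mulrN1z scaleN1r. Qed.

Lemma int_comb_sum M (I : finType) (P : pred I) (F : I -> 'rV_n) :
  (forall i, P i -> int_comb M (F i)) -> int_comb M (\sum_(i | P i) F i).
Proof.
move=> MF; apply: big_ind => //; last exact: int_combD.
by exists 0; rewrite map_mx0 mul0mx.
Qed.

(** The two changes of rows have integer determinants, which are inverse to
    each other unless both determinants vanish. *)
Lemma det_int_comb M M' :
  (forall r, int_comb M (row r M')) -> (forall r, int_comb M' (row r M)) ->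
  (\det M) ^+ 2 = (\det M') ^+ 2.
Proof.
have change A B : (forall r, int_comb A (row r B)) ->
    exists u : int, \det B = u%:~R * \det A.
  move=> AB; have [c cE] := fin_all_exists AB.
  exists (\det (\matrix_(r, j) c r 0 j)); rewrite -det_map_mx -det_mulmx; congr (\det _).
  apply/row_matrixP => r; rewrite row_mul cE; congr (_ *m _).
  by apply/rowP => j; rewrite !mxE.
move=> /change[u M'E] /change[w ME].
have [M0|M_n0] := eqVneq (\det M) 0; first by rewrite M'E M0 mulr0.
have wu : w * u = 1.
  apply/(@intr_inj K)/(mulIf M_n0); rewrite intrM mul1r -mulrA -M'E.
  by rewrite -ME.
have : u ^+ 2 = 1.
  have /intUnitRing.unitzPl := wu.
  by rewrite qualifE => /orP[]/eqP->.
by move=> u2; rewrite M'E exprMn -rmorphXn u2 mul1r.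
Qed.

End IntegerCombinations.

(** In terms of absolute edge types the quad type disappears. *)
Lemma edge_gluing_weight (n : nat) (V : pzRingType) (psi : 'I_3 -> V) q e r
    (i : 'I_n.+1) :
  \sum_k (edge_gluing q e k r i)%:~R * psi (q i + k) =
  \sum_(ab : 'I_4 * 'I_4 | (ab.1 < ab.2)%N && (e (i, ab.1, ab.2) == r))
     psi (edge_type ab.1 ab.2).
Proof.
rewrite (partition_big (fun ab => edge_type ab.1 ab.2 - q i) xpredT) //=.
apply: eq_bigr => k _; rewrite mulr_natl -sumr_const; apply: eq_big => [[a b]|[a b]].
  by rewrite inE /= subr_eq [k + _]addrC -andbA; congr (_ && _); rewrite andbC.
by rewrite inE /= => /and3P[_ /eqP-> _].
Qed.

Lemma loop_gluing_weight (n : nat) (V : pzRingType) (psi : 'I_3 -> V) q p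
    (i : 'I_n.+1) :
  \sum_k (loop_gluing q p k i)%:~R * psi (q i + k) =
  \sum_(x <- p | arc_tet x == i)
     (arc_sign x)%:~R * psi (edge_type (arc_perm x v0) (arc_perm x v3)).
Proof.
rewrite (partition_big (fun x : arc n.+1 =>
  edge_type (arc_perm x v0) (arc_perm x v3) - q i) xpredT) //=.
apply: eq_bigr => k _; rewrite rmorph_sum mulr_suml; apply: eq_big => [x|x].
  by rewrite subr_eq [k + _]addrC.
by case/andP=> _ /eqP->.
Qed.

Section EdgeClasses.
Variables (N : nat) (T : ideal_triangulation N).

Lemma edge_step_nondegenerate x y :
  edge_step T x y -> nondegenerate y = nondegenerate x.
Proof.
case: x => [[i a] b]; case/orP => [/eqP->|/existsP[f /and3P[_ _ /eqP->]]].
  by rewrite /nondegenerate /= eq_sym.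
by rewrite /nondegenerate /= (inj_eq perm_inj).
Qed.

Lemma same_edge_constant (A : Type) (h : cell N -> A) :
  (forall i a b, a != b -> h (i, b, a) = h (i, a, b)) ->
  (forall i a b f, a != b -> f != a -> f != b ->
     h ((glue T i f).1, (glue T i f).2 a, (glue T i f).2 b) = h (i, a, b)) ->
  forall x y, nondegenerate x -> same_edge T x y -> h y = h x.
Proof.
move=> hC hglue x y + /connectP[p + ->] {y}.
elim: p x => //= y p IH x x_nd /andP[xy yp].
have y_nd : nondegenerate y by rewrite (edge_step_nondegenerate xy).
rewrite (IH y y_nd yp); case: x x_nd xy => [[i a] b] ab.
by case/orP => [/eqP->|/existsP[f /and3P[fa fb /eqP->]]]; rewrite (hC, hglue).
Qed.

End EdgeClasses.

Section GluingMatrix.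
Variables (K : numFieldType) (n : nat) (T : ideal_triangulation n.+1).
Local Notation N := n.+1.
Variables (psi : 'I_N -> 'I_3 -> K).
Hypothesis psi0 : forall i, \sum_k psi i k = 0.
Variable (mu : chain N).
Implicit Types D : enhanced_NZ_datum T mu.

(** The rows of G, G' and G'' combined with the weights psi of the edges they
    count; with psi = kappa this is, up to column factors, the matrix whose
    determinant enters tau. *)
Definition weighted_gluing D : 'M[K]_N :=
  \matrix_(r, i) \sum_k (nz_gluing D k r i)%:~R * psi i (nz_quad D i + k).

Definition edge_row (x : cell N) : 'rV[K]_N :=
  \row_i \sum_(ab : 'I_4 * 'I_4 | (ab.1 < ab.2)%N && same_edge T x (i, ab.1, ab.2))
     psi i (edge_type ab.1 ab.2).

Lemma weighted_gluing_edge D x : nondegenerate x -> nz_edge D x != ord_max ->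
  row (nz_edge D x) (weighted_gluing D) = edge_row x.
Proof.
move=> x_nd xm; apply/rowP => i; rewrite !mxE.
under eq_bigr do rewrite mxE (negPf xm).
rewrite edge_gluing_weight; apply: eq_bigl => -[a b] /=.
case ab: (a < b)%N => //=; rewrite eq_sym (nz_edgeP D).1 //.
by rewrite /nondegenerate /= -val_eqE /= ltn_eqF.
Qed.

Lemma edge_reps D : exists c : 'I_N -> cell N,
  forall r, nondegenerate (c r) /\ nz_edge D (c r) = r.
Proof. 
apply: (@fin_all_exists _ _ (fun r x => nondegenerate x /\ nz_edge D x = r)) => r.
by have [x] := (nz_edgeP D).2 r; exists x.
Qed.

Lemma sum_by_edge (V : nmodType) D (c : 'I_N -> cell N) i (F : 'I_4 -> 'I_4 -> V) :
  (forall r, nondegenerate (c r) /\ nz_edge D (c r) = r) ->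
  \sum_(ab : 'I_4 * 'I_4 | (ab.1 < ab.2)%N) F ab.1 ab.2 =
  \sum_r \sum_(ab : 'I_4 * 'I_4 | (ab.1 < ab.2)%N && same_edge T (c r) (i, ab.1, ab.2))
     F ab.1 ab.2.
Proof.
move=> cP; rewrite (partition_big (fun ab => nz_edge D (i, ab.1, ab.2)) xpredT) //=.
apply: eq_bigr => r _; apply: eq_bigl => -[a b] /=.
case ab: (a < b)%N => //=; have [c_nd cr] := cP r.
rewrite -(nz_edgeP D).1 ?cr 1?eq_sym //.
by rewrite /nondegenerate /= -val_eqE /= ltn_eqF.
Qed.

Lemma sum_edge_rows D (c : 'I_N -> cell N) :
  (forall r, nondegenerate (c r) /\ nz_edge D (c r) = r) ->
  \sum_r edge_row (c r) = 0.
Proof.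
move=> cP; apply/rowP => i; rewrite summxE mxE.
under eq_bigr do rewrite mxE.
rewrite -(sum_by_edge i (fun a b => psi i (edge_type a b)) cP).
by rewrite sum_edge_types big_split /= psi0 addr0.
Qed.

(** The row of the omitted edge is minus the sum of the others. *)
Lemma int_comb_edge_row D x :
  nondegenerate x -> int_comb (weighted_gluing D) (edge_row x).
Proof.
move=> x_nd; have [xm|xm] := eqVneq (nz_edge D x) ord_max; last first.
  by rewrite -(weighted_gluing_edge (D := D)) //; exact: int_comb_row.
have [c cP] := edge_reps D.
have -> : edge_row x = - \sum_(r | r != ord_max) edge_row (c r).
  have rows0 := sum_edge_rows cP; rewrite (bigD1 ord_max) //= in rows0.
  rewrite -(addr0_eq rows0) opprK; apply/rowP => i; rewrite !mxE.
  apply: eq_bigl => -[a b] /=; case ab: (a < b)%N => //=.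
  have ab_nd : nondegenerate (i, a, b) by rewrite /nondegenerate /= -val_eqE /= ltn_eqF.
  by have [c_nd cr] := cP ord_max; rewrite -!(nz_edgeP D).1 // cr xm.
apply/int_combN/int_comb_sum => r rm; have [c_nd cr] := cP r.
by rewrite -(weighted_gluing_edge (D := D)) ?cr //; exact: int_comb_row.
Qed.

Lemma loop_row D i : weighted_gluing D ord_max i =
  \sum_(x : cell N | (x.1.1 == i) && nondegenerate x)
     (curve_chain T (nz_loop D) x)%:~R * cell_side_weight psi x.
Proof.
rewrite mxE; under eq_bigr do rewrite mxE eqxx.
rewrite loop_gluing_weight -loop_weight //.
  by apply: eq_bigr => x /eqP <-.
by case: (nz_loopP D) => -[].
Qed.

(** The 2-chain between the two loops has a coefficient at each end of each
    edge of the triangulation; both ends contribute the row of that edge, so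
    only the sum m of the two coefficients matters. *)
Lemma int_comb_loop_row D D' :
  int_comb (weighted_gluing D) (row ord_max (weighted_gluing D')).
Proof.
have [c cP] := edge_reps D.
have [[_ [u [uglue bu]]] [_ [u' [uglue' bu']]]] := (nz_loopP D', nz_loopP D).
pose w x : int := u x - u' x.
pose m x : int := w x + w (x.1.1, x.2, x.1.2).
have m_const : forall x y, nondegenerate x -> same_edge T x y -> m y = m x.
  apply: same_edge_constant => [i a b _|i a b f ab fa fb]; first by rewrite /m addrC.
  by rewrite /m /w /= !uglue ?uglue' // eq_sym.
have -> : row ord_max (weighted_gluing D') =
    row ord_max (weighted_gluing D) + \sum_r (m (c r))%:~R *: edge_row (c r).
  apply/eqP; rewrite addrC -subr_eq; apply/eqP/rowP => i.
  rewrite summxE 2!mxE [X in _ + X]mxE [X in _ - X]mxE !loop_row -sumrB.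
  under eq_bigr do rewrite -mulrBl -intrB.
  rewrite (boundary_weight psi0 (u := w)); last first.
    move=> t te; have := bu' i t te; have := bu i t te; rewrite /w.
    move=> /= e e'; rewrite [RHS](_ : _ = (u (i, t v0, t v3) - u (i, t v0, t v2)) -
      (u' (i, t v0, t v3) - u' (i, t v0, t v2))); last by ring.
    by rewrite -e -e'; ring.
  rewrite sum_cells_at sum_neq_pairs.
  transitivity (\sum_(ab : 'I_4 * 'I_4 | (ab.1 < ab.2)%N)
      (w (i, ab.1, ab.2) + w (i, ab.2, ab.1))%:~R * psi i (edge_type ab.1 ab.2)).
    apply: eq_bigr => -[a b] /= ab; rewrite /corner_weight /= (@edge_typeC b a).
      by rewrite intrD mulrDl.
    by rewrite -val_eqE /= gtn_eqF.
  rewrite (sum_by_edge i (fun a b =>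
    (w (i, a, b) + w (i, b, a))%:~R * psi i (edge_type a b)) cP).
  apply: eq_bigr => r _; rewrite !mxE mulr_sumr; apply: eq_bigr => -[a b] /= /andP[_ re].
  by rewrite -(m_const _ _ (cP r).1 re).
apply/int_combD; first exact: int_comb_row.
by apply/int_comb_sum => r _; apply/int_combZ/int_comb_edge_row; exact: (cP r).1.
Qed.

Lemma det_weighted_gluing D D' :
  (\det (weighted_gluing D)) ^+ 2 = (\det (weighted_gluing D')) ^+ 2.
Proof.
have rows A B r : int_comb (weighted_gluing A) (row r (weighted_gluing B)).
  have [->|rm] := eqVneq r ord_max; first exact: int_comb_loop_row.
  have [x x_nd xr] := (nz_edgeP B).2 r.
  rewrite -xr weighted_gluing_edge ?xr //; exact: int_comb_edge_row.
by apply: det_int_comb; apply: rows.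
Qed.

End GluingMatrix.
(** * Dependence on the quad type and on the flattening *)

Section Kappa.
Variable R : realType.
Implicit Types w : R[i].

(** The squares of these numbers are, up to a common factor, the products of
    squared Ptolemy coordinates over pairs of opposite edges; their sum is the
    Ptolemy relation. *)
Definition kappa w (k : 'I_3) : R[i] :=
  match val k with 0%N => 1 - w | 1%N => w | _ => -1 end.

Lemma sum_kappa w : \sum_k kappa w k = 0.
Proof. by rewrite big_ord3 /kappa /=; ring. Qed.

Lemma kappa_neq0 w k : w != 0 -> w != 1 -> kappa w k != 0.
Proof.
move=> w0 w1; case: k => [[|[|[|//]]] ?]; rewrite /kappa //= ?oppr_eq0 ?oner_eq0 //.
by rewrite subr_eq0 eq_sym.
Qed.

Lemma shape_kappa w k : w != 0 -> w != 1 ->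
  shape w k = - kappa w (k + 1) / kappa w (k + 2%:R).
Proof.
move=> w0 w1; have w1' : 1 - w != 0 by rewrite subr_eq0 eq_sym.
have [->|->|->] := ord3P k; rewrite /shape /kappa /=.
- by field.
- by rewrite opprK mul1r.
- by field.
Qed.

End Kappa.

Section TauSquared.
Variables (R : realType) (n : nat) (T : ideal_triangulation n.+1).
Local Notation N := n.+1.
Variables (z : 'I_N -> R[i]) (mu : chain N).
Hypothesis z_ok : forall i, z i != 0 /\ z i != 1.
Implicit Types D : enhanced_NZ_datum T mu.

Local Notation kap i := (kappa (z i)).

Let kap0 i k : kap i k != 0.
Proof. by case: (z_ok i) => *; apply: kappa_neq0. Qed.

(** The flattening indexed by absolute edge types. *)
Definition flat_weight D (i : 'I_N) (t : 'I_3) : int := nz_flat D (t - nz_quad D i) i.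

(** Uses z_q'' = - kappa_q / kappa_(q+1), 1 / z_q = - kappa_(q+2) / kappa_(q+1)
    and z_q'' + 1 / z_q = 1. *)
Lemma tau_matrix D :
  map_mx intr (nz_A D) *m diag_mx (\row_i nz_z'' D z i) +
    map_mx intr (nz_B D) *m invmx (diag_mx (\row_i nz_z D z i)) =
  weighted_gluing (fun i => kap i) D *m
    diag_mx (\row_i - (kap i (nz_quad D i + 1))^-1).
Proof.
have z0 i : nz_z D z i != 0.
  by rewrite /nz_z shape_kappa ?(z_ok i).1 ?(z_ok i).2 // mulf_neq0 ?oppr_eq0 ?invr_eq0.
have -> : invmx (diag_mx (\row_i nz_z D z i)) = diag_mx (\row_i (nz_z D z i)^-1).
  have di : diag_mx (\row_i nz_z D z i) *m diag_mx (\row_i (nz_z D z i)^-1) = 1%:M.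
    apply/matrixP => r i; rewrite mul_diag_mx !mxE; case: eqP => [->|_].
      by rewrite !mulr1n mulfV.
    by rewrite !mulr0n mulr0.
  have [u _] := mulmx1_unit di; rewrite -[RHS]mul1mx -(mulVmx u) -mulmxA di mulmx1.
  by [].
rewrite !mul_mx_diag; apply/matrixP => r i; rewrite !mxE /nz_z'' /nz_z.
pose g k := if r == ord_max then loop_gluing (nz_quad D) (nz_loop D) k i
  else edge_gluing (nz_quad D) (nz_edge D) k r i.
under eq_bigr do rewrite mxE -/(g _).
rewrite -/(g 0) -/(g 1) -/(g 2%:R) !shape_kappa ?(z_ok i).1 ?(z_ok i).2 //.
have := sum_kappa (z i); set q := nz_quad D i; rewrite (reindex_inj (addrI q)).
rewrite !big_ord3 /= addr0 !mod3_addE.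
have := kap0 i (q + 1); have := kap0 i (q + 2%:R).
move: (kap i q) (kap i (q + 1)) (kap i (q + 2%:R)) => a b c c0 b0 abc.
rewrite !intrB; move: (_%:~R) (_%:~R) (_%:~R) => g0 g1 g2.
have -> : a = - b - c by apply: (addIr (b + c)); rewrite abc; ring.
by field; rewrite b0 c0.
Qed.

Lemma prod_exprz (K : fieldType) (I : Type) (s : seq I) (P : pred I) (x : K)
    (F : I -> int) :
  x != 0 -> \prod_(i <- s | P i) x ^ F i = x ^ (\sum_(i <- s | P i) F i).
Proof. by move=> x0; rewrite (big_morph _ (fun a b => expfzDr a b x0) (expr0z x)). Qed.

Lemma sqr_exprz (K : fieldType) (x : K) (m : int) : (x ^ m) ^+ 2 = (x ^+ 2) ^ m.
Proof. by rewrite !exprnP !exprz_exp mulrC. Qed.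

Lemma tau_sq D :
  tau D z ^+ 2 = (2%:R^-1 * \det (weighted_gluing (fun i => kap i) D)) ^+ 2 *
    \prod_i \prod_k (kap i k ^+ 2) ^ (- flat_weight D i k).
Proof.
rewrite /tau tau_matrix det_mulmx det_diag [_ * (_ * _)]mulrA -mulrA exprMn.
congr (_ * _).
rewrite -big_split /= -prodrXl; apply: eq_bigr => i _; rewrite mxE.
set q := nz_quad D i; rewrite (reindex_inj (addrI q)) big_ord3 /=.
have := flattening_tet (nz_flatP D) i; rewrite big_ord3 /= => f1.
have fw k : flat_weight D i (q + k) = nz_flat D k i.
  by rewrite /flat_weight [q + k]addrC addrK.
rewrite !fw /nz_z /nz_z'' -/q !shape_kappa ?(z_ok i).1 ?(z_ok i).2 //.
rewrite !mod3_addE addr0.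
move: (kap0 i q) (kap0 i (q + 1)) (kap0 i (q + 2%:R)) f1.
move: (kap i q) (kap i (q + 1)) (kap i (q + 2%:R)) => a b c a0 b0 c0.
move: (nz_flat D 0 i) (nz_flat D 1 i) (nz_flat D 2%:R i) => f0 f1 f2 f012.
rewrite 2!exprMn !sqr_exprz !exprMn !sqrrN !exprVn.
move: (expf_neq0 2 b0); move: (a ^+ 2) (b ^+ 2) (c ^+ 2) => A B C B0.
rewrite !expfzMl !exprz_inv opprK -[B^-1]exprN1.
have -> : - f1 = -1 + f2 + f0 by apply: (addIr f1); rewrite addNr -f012; ring.
by rewrite !expfzDr //; ring.
Qed.

Lemma flat_weight_edge D x : nondegenerate x ->
  \sum_i \sum_(ab : 'I_4 * 'I_4 | (ab.1 < ab.2)%N && same_edge T x (i, ab.1, ab.2))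
     flat_weight D i (edge_type ab.1 ab.2) = 2.
Proof.
move=> x_nd; rewrite -(flattening_edge (nz_flatP D) (nz_edge D x)).
apply: eq_bigr => i _.
under [RHS]eq_bigr => k _ do
  rewrite -[edge_gluing _ _ _ _ _]intz
    -[nz_flat D k i](congr1 (nz_flat D ^~ i) (addrK (nz_quad D i) k)) [k + _]addrC.
rewrite (edge_gluing_weight (fun t => nz_flat D (t - nz_quad D i) i)).
apply: eq_bigl => -[a b] /=; case ab: (a < b)%N => //=.
by rewrite eq_sym (nz_edgeP D).1 // /nondegenerate /= -val_eqE /= ltn_eqF.
Qed.

Lemma sum_flat_weight D i : \sum_k flat_weight D i k = 1.
Proof.
rewrite /flat_weight -(flattening_tet (nz_flatP D) i).
by rewrite [RHS](reindex_inj (addIr (- nz_quad D i))).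
Qed.

(** The hypotheses on h and L say that h is a function on the edges of the
    triangulation in terms of which kappa^2 has the form of a squared cross
    ratio.  The exponents d of the quotient of the two monomials add up to 0 in
    each tetrahedron, so that L cancels, and around each edge, so that h does. *)
Lemma flat_monomial_invariant (h : cell N -> R[i]) (L : 'I_N -> R[i]) D D' :
  (forall x, nondegenerate x -> h x != 0) ->
  (forall x y, nondegenerate x -> same_edge T x y -> h y = h x) ->
  (forall i, L i != 0) ->
  (forall i k,
     \prod_(ab : 'I_4 * 'I_4 | (ab.1 < ab.2)%N && (edge_type ab.1 ab.2 == k))
        h (i, ab.1, ab.2) = L i * kap i k ^+ 2) ->
  \prod_i \prod_k (kap i k ^+ 2) ^ (- flat_weight D i k) =
  \prod_i \prod_k (kap i k ^+ 2) ^ (- flat_weight D' i k).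
Proof.
move=> h0 h_const L0 hL; have [c cP] := edge_reps D.
have nd (a b : 'I_4) (i : 'I_N) : (a < b)%N -> nondegenerate (i, a, b).
  by move=> ab; rewrite /nondegenerate /= -val_eqE /= ltn_eqF.
pose d i k := flat_weight D' i k - flat_weight D i k.
suff d1 : \prod_i \prod_k (kap i k ^+ 2) ^ d i k = 1.
  rewrite -[RHS]mulr1 -[X in _ * X]d1 -big_split /=; apply: eq_bigr => i _.
  rewrite -big_split /=; apply: eq_bigr => k _; rewrite -expfzDr ?expf_neq0 //.
  by congr (_ ^ _); rewrite /d; ring.
transitivity (\prod_i \prod_k (L i * kap i k ^+ 2) ^ d i k).
  apply: eq_bigr => i _; under [RHS]eq_bigr do rewrite expfzMl.
  by rewrite big_split /= (prod_exprz _ _ _ (L0 i)) sumrB !sum_flat_weight subrr expr0z mul1r.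
transitivity (\prod_i \prod_(ab : 'I_4 * 'I_4 | (ab.1 < ab.2)%N)
   h (i, ab.1, ab.2) ^ d i (edge_type ab.1 ab.2)).
  apply: eq_bigr => i _.
  rewrite [RHS](partition_big (fun ab => edge_type ab.1 ab.2) xpredT) //=.
  apply: eq_bigr => k _; rewrite -hL.
  rewrite (big_morph (fun x => x ^ d i k) (fun x y => expfzMl x y _)
             (exp1rz _ (d i k))).
  by apply: eq_bigr => ab /andP[_ /eqP->].
transitivity (\prod_r \prod_i \prod_(ab : 'I_4 * 'I_4 |
    (ab.1 < ab.2)%N && same_edge T (c r) (i, ab.1, ab.2))
   h (i, ab.1, ab.2) ^ d i (edge_type ab.1 ab.2)).
  rewrite [RHS]exchange_big; apply: eq_bigr => i _.
  rewrite (partition_big (fun ab => nz_edge D (i, ab.1, ab.2)) xpredT) //=.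
  apply: eq_bigr => r _; apply: eq_bigl => -[a b] /=; case ab: (a < b)%N => //=.
  by have [c_nd cr] := cP r; rewrite -(nz_edgeP D).1 ?cr 1?eq_sym //; exact: nd.
apply: big1 => r _; have [c_nd _] := cP r.
transitivity (h (c r) ^ \sum_i \sum_(ab : 'I_4 * 'I_4 |
    (ab.1 < ab.2)%N && same_edge T (c r) (i, ab.1, ab.2)) d i (edge_type ab.1 ab.2)).
  rewrite -(prod_exprz _ _ _ (h0 _ c_nd)); apply: eq_bigr => i _.
  rewrite -(prod_exprz _ _ _ (h0 _ c_nd)).
  by apply: eq_bigr => -[a b] /= /andP[_ /h_const ->].
under eq_bigr do rewrite sumrB.
by rewrite sumrB !flat_weight_edge // subrr.
Qed.

End TauSquared.
(** * Linear algebra in dimension two *)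

Section TwoByTwo.
Variable K : fieldType.
Implicit Types (g : 'M[K]_2) (u v w : 'cV[K]_2).

Lemma sum_ord2 (V : nmodType) (F : 'I_2 -> V) : \sum_i F i = F 0 + F 1.
Proof.
rewrite !big_ord_recl big_ord0 addr0.
by have -> : lift ord0 ord0 = 1 :> 'I_2 by apply: val_inj.
Qed.

Lemma det2 g : \det g = g 0 0 * g 1 1 - g 0 1 * g 1 0.
Proof.
rewrite (expand_det_row _ 0) sum_ord2 /cofactor !det_mx11 !mxE /=.
have -> : lift (0 : 'I_2) 0 = 1 by apply: val_inj.
have -> : lift (1 : 'I_2) 0 = 0 by apply: val_inj.
by rewrite expr0 expr1 mul1r mulN1r mulrN.
Qed.

Lemma mxtrace2 g : \tr g = g 0 0 + g 1 1.
Proof. exact: sum_ord2. Qed.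

(** The determinant of the matrix with columns u and v; it is invariant under
    SL_2, which is what makes Ptolemy coordinates well defined. *)
Definition cross u v : K := u 0 0 * v 1 0 - u 1 0 * v 0 0.

Lemma cross_mulmx g u v : cross (g *m u) (g *m v) = \det g * cross u v.
Proof. by rewrite det2 /cross !mxE !sum_ord2; ring. Qed.

Lemma crossZ a b u v : cross (a *: u) (b *: v) = a * b * cross u v.
Proof. by rewrite /cross !mxE; ring. Qed.

Lemma crossC u v : cross u v = - cross v u.
Proof. by rewrite /cross; ring. Qed.

Lemma plucker u v w r : cross u v * w r 0 = cross w v * u r 0 + cross u w * v r 0.
Proof. by rewrite /cross; case: (ord2P r) => ->; ring. Qed.

(** SL_2 acts 3-transitively on the projective line as soon as square roots
    exist: q1 and q2 can be sent to any multiples of p1 and p2, the ratio of the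
    two factors is fixed by q3, and their common scale k by the determinant. *)
Lemma three_transitive (p1 p2 p3 q1 q2 q3 : 'cV[K]_2) :
  (forall x : K, exists y, y ^+ 2 = x) ->
  cross p1 p2 != 0 -> cross p1 p3 != 0 -> cross p2 p3 != 0 ->
  cross q1 q2 != 0 -> cross q1 q3 != 0 -> cross q2 q3 != 0 ->
  exists2 g, \det g = 1 &
    [/\ exists c, g *m q1 = c *: p1, exists c, g *m q2 = c *: p2 &
        exists c, g *m q3 = c *: p3].
Proof.
move=> sqrtK p12 p13 p23 q12 q13 q23.
have [k k2] : exists k, k ^+ 2 * (cross p2 p3 * cross p1 p3 * cross p1 p2) =
    cross q2 q3 * cross q1 q3 * cross q1 q2.
  have [k k2] := sqrtK ((cross q2 q3 * cross q1 q3 * cross q1 q2) /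
                        (cross p2 p3 * cross p1 p3 * cross p1 p2)).
  by exists k; rewrite k2 divfK // !mulf_neq0.
pose a := k * cross p2 p3 / cross q2 q3; pose b := k * cross p1 p3 / cross q1 q3.
(* J q is the row vector of the linear form sending x to cross x q. *)
pose J (q : 'cV[K]_2) (s : 'I_2) := if s == 0 then q 1 0 else - q 0 0.
pose g : 'M[K]_2 := \matrix_(r, s)
  ((a * p1 r 0 * J q2 s - b * p2 r 0 * J q1 s) / cross q1 q2).
have gE x r : (g *m x) r 0 =
    (a * p1 r 0 * cross x q2 - b * p2 r 0 * cross x q1) / cross q1 q2.
  by rewrite !mxE sum_ord2 !mxE /J /= [cross x q2]/cross [cross x q1]/cross; ring.
have g1 : g *m q1 = a *: p1.
  apply/colP => r; rewrite gE mxE [cross q1 q1]/cross; field; exact: q12.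
have g2 : g *m q2 = b *: p2.
  apply/colP => r; rewrite gE mxE [cross q2 q2]/cross [cross q2 q1]crossC; field; exact: q12.
exists g.
  apply: (mulIf q12); rewrite -cross_mulmx g1 g2 crossZ mul1r /a /b.
  apply: (mulIf (mulf_neq0 q13 q23)).
  rewrite [RHS](_ : _ = cross q2 q3 * cross q1 q3 * cross q1 q2); last by ring.
  by rewrite -k2; field; rewrite q13 q23.
split; [by exists a | by exists b | exists (k * cross p1 p2 / cross q1 q2)].
apply/colP => r; rewrite gE mxE [RHS](_ : _ =
  k * (cross p1 p2 * p3 r 0) / cross q1 q2); last by ring.
rewrite plucker.
rewrite [cross q3 q2]crossC [cross q3 q1]crossC [cross p3 p2]crossC /a /b.
by field; rewrite q12 q13 q23.
Qed.
Lemma eigenvalue2 g w e :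
  w != 0 -> g *m w = e *: w -> e ^+ 2 - \tr g * e + \det g = 0.
Proof.
move=> w0 /colP gw; have := gw 0; have := gw 1; rewrite !mxE !sum_ord2 => e1 e0.
rewrite det2 mxtrace2.
have [r wr] : exists r, w r 0 != 0.
  have [w00|w00] := eqVneq (w 0 0) 0; last by exists 0.
  have [w10|w10] := eqVneq (w 1 0) 0; last by exists 1.
  case/negP: w0; apply/eqP/colP => r; rewrite mxE.
  by case: (ord2P r) => ->.
apply: (mulIf wr); rewrite mul0r.
have f0 : g 0 1 * w 1 0 = (e - g 0 0) * w 0 0 by rewrite mulrBl -e0; ring.
have f1 : g 1 0 * w 0 0 = (e - g 1 1) * w 1 0 by rewrite mulrBl -e1; ring.
case: (ord2P r) => ->.
  transitivity ((e - g 0 0) * w 0 0 * (e - g 1 1) - g 0 1 * (g 1 0 * w 0 0)); first by ring.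
  by rewrite f1 -f0; ring.
transitivity ((e - g 1 1) * w 1 0 * (e - g 0 0) - g 1 0 * (g 0 1 * w 1 0)); first by ring.
by rewrite f0 -f1; ring.
Qed.

(** The nilpotent map sending x to cross x w *: w. *)
Definition shear w : 'M[K]_2 :=
  \matrix_(r, s) (w r 0 * (if s == 0 then w 1 0 else - w 0 0)).

(** A nonzero vector killed by a nilpotent 2x2 matrix spans its image too, so
    it determines the matrix up to a factor. *)
Lemma nilpotent_shear m w : w != 0 -> m *m w = 0 -> \tr m = 0 ->
  exists s, m = s *: shear w.
Proof.
move=> w0 /colP mw; have := mw 0; have := mw 1; rewrite !mxE !sum_ord2 mxtrace2.
move=> e1 e0 /eqP; rewrite addrC addr_eq0 => /eqP m11; rewrite m11 in e1.
(* The factor is read off an off-diagonal entry of m. *)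
have [w00|w00] := eqVneq (w 0 0) 0.
  have w10 : w 1 0 != 0.
    apply: contra_neq w0 => w10; apply/colP => r; rewrite mxE.
    by case: (ord2P r) => ->.
  exists (m 1 0 / (w 1 0 * w 1 0)); apply/matrixP => r s.
  move: e0 e1; rewrite w00 !mulr0 !add0r => /eqP; rewrite mulf_eq0 (negPf w10) orbF => /eqP m01.
  move=> /eqP; rewrite mulNr oppr_eq0 mulf_eq0 (negPf w10) orbF => /eqP m00.
  case: (ord2P r) => ->; case: (ord2P s) => ->; rewrite !mxE /= ?w00 ?m01 ?m11 ?m00; try ring.
  by field.
exists (- m 0 1 / (w 0 0 * w 0 0)); apply/matrixP => r s.
have m00 : m 0 0 = - (m 0 1 * w 1 0) / w 0 0.
  by apply: (mulIf w00); rewrite divfK //; apply/eqP; rewrite -addr_eq0 e0.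
have m10 : m 1 0 = m 0 0 * w 1 0 / w 0 0.
  by apply: (mulIf w00); rewrite divfK //; apply/eqP; rewrite -subr_eq0 -mulNr e1.
by case: (ord2P r) => ->; case: (ord2P s) => ->; rewrite !mxE /= ?m11 ?m10 ?m00; field.
Qed.

Lemma cayley_hamilton2 g : g *m g = \tr g *: g - (\det g)%:M.
Proof.
apply/matrixP => r s; rewrite !mxE sum_ord2 mxtrace2 det2.
by case: (ord2P r) => ->; case: (ord2P s) => -> /=; ring.
Qed.

(** Squaring removes the sign of g; the factor s does not vanish because, by the
    Cayley-Hamilton theorem, g^2 = 1 would make g scalar. *)
Lemma parabolic_square g w e : (2%:R : K) != 0 -> w != 0 ->
  g *m w = e *: w -> e ^+ 2 = 1 -> \det g = 1 -> \tr g ^+ 2 = 4%:R ->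
  g <> 1%:M -> g <> - 1%:M ->
  exists2 s, s != 0 & g *m g = 1%:M + s *: shear w.
Proof.
move=> K2 w0 gw e2 dg tr2 g1 gN1.
have [] := @nilpotent_shear (g *m g - 1%:M) w w0.
- by rewrite mulmxBl mul1mx -mulmxA gw -scalemxAr gw scalerA -expr2 e2 scale1r subrr.
- rewrite cayley_hamilton2 dg !raddfB /= linearZ /= !mxtrace1 -expr2 tr2; ring.
move=> s ggs; exists s; last by rewrite -ggs addrC subrK.
apply/eqP => s0; move: ggs; rewrite s0 scale0r => /eqP; rewrite subr_eq0.
rewrite cayley_hamilton2 dg subr_eq -[_ + _]mulr2n => /eqP trg.
have /eqP : (\tr g - 2%:R) * (\tr g + 2%:R) = 0.
  by rewrite -[LHS]subr0 -(subrr (4%:R : K)) -{1}tr2; ring.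
rewrite mulf_eq0 subr_eq0 addr_eq0 => /orP[]/eqP tr; move: trg; rewrite tr.
  rewrite scaler_nat => /(congr1 ( *:%R 2%:R^-1)); rewrite -!scaler_nat.
  rewrite !scalerA mulVf // !scale1r.
  exact: g1.
rewrite scaleNr scaler_nat => /(congr1 ( *:%R (- 2%:R^-1))).
by rewrite -!scaler_nat scaleNr scalerN opprK !scaleNr !scalerA mulVf // !scale1r.
Qed.

Lemma tr_shear2 a b u v :
  \tr ((a *: shear u) *m (b *: shear v)) = - (a * b * cross u v ^+ 2).
Proof. by rewrite mxtrace2 !mxE !sum_ord2 !mxE /= /cross; ring. Qed.

Lemma tr_shear4 a b c d p q u v :
  \tr ((a *: shear p) *m (b *: shear q) *m (c *: shear u) *m (d *: shear v)) =
  a * b * c * d * (cross p v * cross v u * cross u q * cross q p).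
Proof.
by rewrite mxtrace2 !(mxE, sum_ord2) /= /cross; ring.
Qed.
End TwoByTwo.

(** * Ideal vertices and face pairings *)

Section Vertices.
Variable R : realType.
Implicit Types w : R[i].

Lemma cross_ideal_vertex w :
  ((cross (ideal_vertex w v0) (ideal_vertex w v1) = 1) *
   (cross (ideal_vertex w v0) (ideal_vertex w v2) = 1) *
   (cross (ideal_vertex w v0) (ideal_vertex w v3) = 1) *
   (cross (ideal_vertex w v1) (ideal_vertex w v2) = -1) *
   (cross (ideal_vertex w v1) (ideal_vertex w v3) = - w) *
   (cross (ideal_vertex w v2) (ideal_vertex w v3) = 1 - w))%type.
Proof. by do !split; rewrite /cross /ideal_vertex /= !mxE /=; ring. Qed.

Lemma cross_ideal_vertex_neq0 w a b : w != 0 -> w != 1 -> a != b ->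
  cross (ideal_vertex w a) (ideal_vertex w b) != 0.
Proof.
move=> w0 w1; have w1' : 1 - w != 0 by rewrite subr_eq0 eq_sym.
wlog ab : a b / (a < b)%N => [hwlog|_].
  case: (ltngtP a b) => [lt|lt|/val_inj->]; first exact: hwlog.
    by move=> ne; rewrite crossC oppr_eq0; apply: hwlog => //; rewrite eq_sym.
  by rewrite eqxx.
by case: (ord4P a) ab => ->; case: (ord4P b) => -> //; rewrite cross_ideal_vertex ?oppr_eq0 ?oner_eq0.
Qed.

Lemma ideal_vertex_neq0 w a : ideal_vertex w a != 0.
Proof.
apply/eqP => /colP e; case: (ord4P a) e => -> e.
- by have /eqP := e 0; rewrite /ideal_vertex /= !mxE /= oner_eq0.
- by have /eqP := e 1; rewrite /ideal_vertex /= !mxE /= oner_eq0.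
- by have /eqP := e 1; rewrite /ideal_vertex /= !mxE /= oner_eq0.
- by have /eqP := e 1; rewrite /ideal_vertex /= !mxE /= oner_eq0.
Qed.

Lemma face_pairing_exists (N : nat) (T : ideal_triangulation N)
    (z : 'I_N -> R[i]) i f :
  (forall i, z i != 0 /\ z i != 1) ->
  exists g, face_pairing T z i f g.
Proof.
move=> z_ok; set j := (glue T i f).1; set s := (glue T i f).2.
pose t := tperm v0 f.
have nz (k : 'I_N) (p : {perm 'I_4}) (a b : 'I_4) : a != b ->
    cross (ideal_vertex (z k) (p a)) (ideal_vertex (z k) (p b)) != 0.
  move=> ab; apply: cross_ideal_vertex_neq0; rewrite ?(inj_eq perm_inj) //.
    exact: (z_ok k).1.
  exact: (z_ok k).2.
have roots (x : R[i]) : exists y, y ^+ 2 = x.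
  by exists (sqrtc x); rewrite sqr_sqrtc.
have [g detg [g1 g2 g3]] := three_transitive roots
  (nz i t v1 v2 isT) (nz i t v1 v3 isT) (nz i t v2 v3 isT)
  (nz j (t * s)%g v1 v2 isT) (nz j (t * s)%g v1 v3 isT)
  (nz j (t * s)%g v2 v3 isT).
rewrite !permM in g1 g2 g3.
exists g; split=> // w wf.
have [u wu] : exists u, w = t u by exists (t w); rewrite tpermK.
rewrite {w}wu in wf *; case: (ord4P u) wf => {u}-> wf.
- by case/eqP: wf; exact: tpermL.
- exact: g1.
- exact: g2.
- exact: g3.
Qed.

End Vertices.
(** * Walks on the cusp torus *)

Section LinkWalks.
Variables (N : nat) (T : ideal_triangulation N).

Lemma null_homologousB (c d : chain N) :
  null_homologous T c -> null_homologous T d ->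
  null_homologous T (fun x => c x - d x).
Proof.
move=> [u [ug cu]] [u' [ug' du]]; exists (fun x => u x - u' x); split.
  by move=> i v w f vw fv fw; rewrite ug ?ug'.
move=> i t te; have := cu i t te; have := du i t te; rewrite !subr0 => -> ->; ring.
Qed.

Lemma homologous_null (c d : chain N) :
  homologous T c d -> null_homologous T c -> null_homologous T d.
Proof.
move=> [u [ug cu]] [u' [ug' du]]; exists (fun x => u' x - u x); split.
  by move=> i v w f vw fv fw; rewrite ug ?ug'.
move=> i t te; have := cu i t te; have := du i t te; rewrite !subr0 => -> e.
rewrite [RHS](_ : _ = (u' (i, t v0, t v3) - u' (i, t v0, t v2)) -
   (u (i, t v0, t v3) - u (i, t v0, t v2))); last by ring.
by rewrite -e; ring.
Qed.

Lemma null_homologous_ext (c d : chain N) : c =1 d ->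
  null_homologous T c -> null_homologous T d.
Proof. by move=> cd [u [ug cu]]; exists u; split=> // i t te; rewrite -cd cu. Qed.

Lemma link_sides_cat i v s s' :
  link_sides T i v (s ++ s') = link_sides T i v s ++
    link_sides T (link_walk_end T (i, v) s).1 (link_walk_end T (i, v) s).2 s'.
Proof. by elim: s i v => //= w s IH i v; rewrite IH. Qed.

Lemma link_walk_end_cat x s s' :
  link_walk_end T x (s ++ s') = link_walk_end T (link_walk_end T x s) s'.
Proof. exact: foldl_cat. Qed.

Lemma link_walk_endE i v s : (link_walk_end T (i, v) s).1 = walk_end T i s.
Proof. by elim: s i v => //= w s IH i v; rewrite -IH. Qed.

Definition walk_chain (x : 'I_N * 'I_4) s : chain N :=
  crossing_chain T (link_sides T x.1 x.2 s).

Definition link_walk (x : 'I_N * 'I_4) s (y : 'I_N * 'I_4) : Prop :=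
  all (@nondegenerate N) (link_sides T x.1 x.2 s) /\ link_walk_end T x s = y.

Lemma link_walk_cat x y y' s s' : link_walk x s y -> link_walk y s' y' ->
  link_walk x (s ++ s') y'.
Proof.
case: x => i v [nd e] [nd' e']; split; last by rewrite link_walk_end_cat e.
by rewrite /= link_sides_cat all_cat nd e.
Qed.

Lemma walk_chain_cat x y s s' : link_walk x s y ->
  walk_chain x (s ++ s') =1 (fun a => walk_chain x s a + walk_chain y s' a).
Proof.
case: x => i v [nd e] a; rewrite /walk_chain /crossing_chain /= link_sides_cat e.
by rewrite !count_cat !PoszD; ring.
Qed.

Lemma connect_link_walk x y :
  connect (link_step T) x y -> exists s, link_walk x s y.
Proof.
case/connectP => p; elim: p x => [|y' p IH] x /=; first by move=> _ ->; exists [::].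
case/andP=> /existsP[f /andP[fx /eqP y'E]] /IH{IH}IH /IH[s [nd e]].
exists (f :: s); split; last by rewrite /= -y'E.
by rewrite /= /Defs.nondegenerate /= eq_sym fx; rewrite y'E in nd.
Qed.

Definition essential x s : Prop :=
  link_walk x s x /\ ~ null_homologous T (walk_chain x s).

(** Go from y to x along q and return along r.  If q r is null-homologous, then
    q s r is not, as its class differs from that of q r by the class of s. *)
Lemma essential_at x y s : (forall x y, connect (link_step T) x y) ->
  essential x s -> exists s', essential y s'.
Proof.
move=> conn [xs s_n0].
have [q yx] := connect_link_walk (conn y x); have [r xy] := connect_link_walk (conn x y).
have [qr0|qr_n0] := boolp.EM (null_homologous T (walk_chain y (q ++ r))); last first.
  by exists (q ++ r); split=> //; apply: link_walk_cat xy.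
exists (q ++ s ++ r); split; first exact: link_walk_cat yx (link_walk_cat xs xy).
move=> qsr0; apply: s_n0; apply: null_homologous_ext (null_homologousB qsr0 qr0) => a /=.
by rewrite !(walk_chain_cat _ yx) (walk_chain_cat _ xs); ring.
Qed.

Lemma curve_walk p : simple_closed_curve T p -> p <> [::] ->
  exists x s, link_walk x s x /\ walk_chain x s = curve_chain T p.
Proof.
case=> + _; case: p => // x p /= + _; set q := x :: p => cyc.
exists (arc_tet x, arc_perm x v0), [seq arc_perm y v2 | y <- q].
have E y r : path (arc_next T q) y r ->
    link_sides T (arc_tet y) (arc_perm y v0) [seq arc_perm a v2 | a <- belast y r] =
      [seq arc_exit a | a <- belast y r] /\
    link_walk_end T (arc_tet y, arc_perm y v0) [seq arc_perm a v2 | a <- belast y r] =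
      (arc_tet (last y r), arc_perm (last y r) v0).
  elim: r y => [|a r IH] y //= /andP[/and4P[/eqP e1 /eqP e2 _ _] /IH[IH1 IH2]].
  by rewrite -e1 -e2 IH1 IH2.
have [] := E _ _ cyc; rewrite belast_rcons last_rcons -/q => E1 E2.
split; last by rewrite /walk_chain E1.
split=> //; rewrite E1 all_map; apply/allP => y _ /=.
by rewrite /Defs.nondegenerate /= (inj_eq perm_inj).
Qed.

(** The triangles through which the meridian loop passes form such a walk. *)
Lemma essential_loop (mu : chain N) p : ~ null_homologous T mu ->
  meridian_loop T mu p -> exists x s, essential x s.
Proof.
move=> mu_n0 [p_scc p_mu].
have p_n0 : ~ null_homologous T (curve_chain T p) by move/(homologous_null p_mu).
have p_nil : p <> [::].
  move=> p0; apply: p_n0; exists (fun=> 0); split=> // i t _.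
  by rewrite p0 /curve_chain /crossing_chain /= subrr.
have [x [s [xs sp]]] := curve_walk p_scc p_nil.
by exists x, s; split=> //; rewrite sp.
Qed.

End LinkWalks.

(** * Ptolemy coordinates *)

Section Potential.
Variables (R : realType) (N : nat) (T : ideal_triangulation N) (z : 'I_N -> R[i]).
Hypothesis z_ok : forall i, z i != 0 /\ z i != 1.
Local Notation vertex i v := (ideal_vertex (z i) v).

Variable g : 'I_N -> 'I_4 -> 'M[R[i]]_2.
Hypothesis gP : forall i f, face_pairing T z i f (g i f).
(* The factor by which crossing the side (i, v, f) rescales the vector of the
   ideal vertex v. *)
Variable sc : cell N -> R[i].
Hypothesis scP : forall i v f, v != f ->
  g i f *m vertex (glue T i f).1 ((glue T i f).2 v) = sc (i, v, f) *: vertex i v.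

Fixpoint walk_hol (i : 'I_N) (s : seq 'I_4) : 'M[R[i]]_2 :=
  if s is f :: s' then g i f *m walk_hol (glue T i f).1 s' else 1%:M.

Definition multiplier (x : 'I_N * 'I_4) s : R[i] :=
  \prod_(a <- link_sides T x.1 x.2 s) sc a.

Lemma walk_holP i s : holonomy T z i s (walk_hol i s).
Proof.
by elim: s i => //= f s IH i; exists (g i f), (walk_hol (glue T i f).1 s).
Qed.

Lemma walk_hol_vertex x s y : link_walk T x s y ->
  walk_hol x.1 s *m vertex y.1 y.2 = multiplier x s *: vertex x.1 x.2.
Proof.
rewrite /multiplier; elim: s x => [|f s IH] [i v] [/= nd e].
  by rewrite big_nil scale1r mul1mx -e.
have [vf {}nd] := andP nd; rewrite big_cons -mulmxA.
rewrite (IH ((glue T i f).1, (glue T i f).2 v)) /=; last by split.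
by rewrite -scalemxAr scP // scalerA mulrC.
Qed.

Lemma multiplier_cat x y s s' : link_walk T x s y ->
  multiplier x (s ++ s') = multiplier x s * multiplier y s'.
Proof. by case: x => i v [nd e]; rewrite /multiplier /= link_sides_cat big_cat e. Qed.

Lemma det_walk_hol i s : \det (walk_hol i s) = 1.
Proof.
by elim: s i => [|f s IH] i /=; rewrite ?det1 // det_mulmx (gP i f).1 mul1r IH.
Qed.

Lemma multiplier_neq0 x s y : link_walk T x s y -> multiplier x s != 0.
Proof.
move=> xs; apply/eqP => e; have := walk_hol_vertex xs; rewrite e scale0r => h0.
have u : walk_hol x.1 s \in unitmx by rewrite unitmxE det_walk_hol unitr1.
have := mulKmx u (vertex y.1 y.2); rewrite h0 mulmx0 => /esym/eqP.
by rewrite (negPf (ideal_vertex_neq0 _ _)).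
Qed.

Hypothesis cusp : forall j v s h, closed_link_walk T j v s ->
  ~ null_homologous T (crossing_chain T (link_sides T j v s)) ->
  holonomy T z j s h -> parabolic h.
Hypothesis conn : forall x y, connect (link_step T) x y.

(** An eigenvalue e of a matrix of determinant 1 and trace 2 or -2 satisfies
    (e^2 + 1)^2 = 4 e^2. *)
Lemma essential_multiplier x s : essential T x s -> multiplier x s ^+ 2 = 1.
Proof.
move=> [xs s_n0].
have [tr2 _ _] : parabolic (walk_hol x.1 s).
  by apply: cusp s_n0 (walk_holP _ _); case: x xs.
have := eigenvalue2 (ideal_vertex_neq0 _ _) (walk_hol_vertex xs).
rewrite det_walk_hol; move: (multiplier x s) => e eq.
have e2 : e ^+ 2 + 1 = \tr (walk_hol x.1 s) * e.
  by apply/eqP; rewrite -subr_eq0 addrAC eq.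
have : (e ^+ 2 - 1) ^+ 2 = (e ^+ 2 + 1) ^+ 2 - 4%:R * e ^+ 2 by ring.
by rewrite e2 exprMn tr2 subrr => /eqP; rewrite sqrf_eq0 subr_eq0 => /eqP.
Qed.

(** Parabolicity is only available along essential walks; appending one of them
    makes a null-homologous walk essential. *)
Lemma closed_multiplier x0 s0 x s : essential T x0 s0 -> link_walk T x s x ->
  multiplier x s ^+ 2 = 1.
Proof.
move=> ess xs; have [r r_ess] := essential_at x conn ess.
have [s0_null|s_n0] := boolp.EM (null_homologous T (walk_chain T x s));
  last exact: essential_multiplier.
have sr_ess : essential T x (s ++ r).
  have [xr r_n0] := r_ess; split; first exact: link_walk_cat xs xr.
  move=> sr0; apply: r_n0; apply: null_homologous_ext (null_homologousB sr0 s0_null) => a /=.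
  by rewrite (walk_chain_cat _ xs); ring.
have := essential_multiplier sr_ess.
by rewrite (multiplier_cat _ xs) exprMn (essential_multiplier r_ess) mulr1.
Qed.

(** Squared multipliers are trivial along closed walks, so they come from a
    function on the triangles of the cusp torus: rho is the square of the factor
    that makes the vectors of the ideal vertices equivariant up to sign. *)
Lemma potential x0 s0 : essential T x0 s0 ->
  exists rho : 'I_N * 'I_4 -> R[i],
    (forall x, rho x != 0) /\
    (forall i v f, v != f ->
       rho ((glue T i f).1, (glue T i f).2 v) * sc (i, v, f) ^+ 2 =
       rho (i, v)).
Proof.
move=> ess.
have [q qP] := fin_all_exists (fun x => connect_link_walk (conn x0 x)).
exists (fun x => (multiplier x0 (q x) ^+ 2)^-1); split=> [x|i v f vf].
  by rewrite invr_eq0 expf_neq0 // (multiplier_neq0 (qP x)).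
set x := (i, v); set y := (_, _).
have [r rP] := connect_link_walk (conn y x0).
have xfy : link_walk T x [:: f] y by rewrite /x /y; split; rewrite //= andbT.
have c1 := closed_multiplier ess (link_walk_cat (qP y) rP).
have c2 := closed_multiplier ess (link_walk_cat (qP x) (link_walk_cat xfy rP)).
move: c2 c1; rewrite (multiplier_cat _ (qP x)) (multiplier_cat _ xfy).
rewrite (multiplier_cat _ (qP y)).
have -> : multiplier x [:: f] = sc (i, v, f) by rewrite /multiplier /= big_seq1.
have := multiplier_neq0 rP; have := multiplier_neq0 (qP y).
have := multiplier_neq0 (qP x).
move: (multiplier x0 (q x)) (multiplier x0 (q y)) (multiplier y r).
move=> a b c a0 b0 c0 e1 e2.
have : (a * sc (i, v, f)) ^+ 2 = b ^+ 2.
  apply: (mulIf (expf_neq0 2 c0)); rewrite -!exprMn e2 -e1; ring.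
rewrite exprMn => sc2; rewrite -sc2; field.
by rewrite a0 -(sqrf_eq0 (sc _)) -(mulrI_eq0 _ (mulfI (expf_neq0 2 a0))) sc2 expf_neq0.
Qed.

(** The squared Ptolemy coordinates h, computed in the standard copy of a
    tetrahedron with the rescaled vectors; L collects the scaling factors. *)
Lemma edge_lengths x0 s0 : essential T x0 s0 ->
  exists (h : cell N -> R[i]) (L : 'I_N -> R[i]),
  [/\ forall x, nondegenerate x -> h x != 0,
      forall x y, nondegenerate x -> same_edge T x y -> h y = h x,
      forall i, L i != 0 &
      forall i k,
        \prod_(ab : 'I_4 * 'I_4 |
            (ab.1 < ab.2)%N && (edge_type ab.1 ab.2 == k))
          h (i, ab.1, ab.2) = L i * kappa (z i) k ^+ 2].
Proof.
move=> ess; have [rho [rho0 rhoP]] := potential ess.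
exists (fun x => rho x.1 * rho (x.1.1, x.2) *
  cross (vertex x.1.1 x.1.2) (vertex x.1.1 x.2) ^+ 2).
exists (fun i => rho (i, v0) * rho (i, v1) * rho (i, v2) * rho (i, v3)); split.
- case=> [[i a] b] ab; rewrite mulf_neq0 ?expf_neq0 ?mulf_neq0 //.
  by apply: cross_ideal_vertex_neq0; rewrite ?(z_ok i).1 ?(z_ok i).2.
- apply: same_edge_constant => [i a b _|i a b f ab fa fb] /=.
    by rewrite crossC sqrrN; ring.
  rewrite -(rhoP i a f) ?(eq_sym a) // -(rhoP i b f) ?(eq_sym b) //.
  have := cross_mulmx (g i f) (vertex (glue T i f).1 ((glue T i f).2 a))
                              (vertex (glue T i f).1 ((glue T i f).2 b)).
  rewrite (gP i f).1 mul1r !scP 1?eq_sym // crossZ => <-; ring.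
- by move=> i; rewrite !mulf_neq0.
move=> i k; rewrite (big_edge_type _ (fun a b => rho (i, a) * rho (i, b) *
  cross (vertex i a) (vertex i b) ^+ 2)).
by case: (ord3P k) => ->; rewrite /kappa /= !cross_ideal_vertex; ring.
Qed.

End Potential.
(** * Shapes lie in the invariant trace field *)

Section GeneratedField.
Variables (R : realType) (S : R[i] -> Prop).
Local Notation E := (generated_field S).

Lemma generated_zero : E 0.
Proof. by rewrite -(subrr 1); apply: generated_sub; exact: generated_one. Qed.

Lemma generated_opp x : E x -> E (- x).
Proof. by rewrite -sub0r; apply: generated_sub; exact: generated_zero. Qed.

Lemma generated_add x y : E x -> E y -> E (x + y).
Proof. by move=> Ex Ey; rewrite -[y]opprK; apply/generated_sub/generated_opp. Qed.

Lemma generated_sum I (r : seq I) (P : pred I) F :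
  (forall i, P i -> E (F i)) -> E (\sum_(i <- r | P i) F i).
Proof. by apply: big_ind; [exact: generated_zero | exact: generated_add]. Qed.

Lemma generated_prod I (r : seq I) (P : pred I) F :
  (forall i, P i -> E (F i)) -> E (\prod_(i <- r | P i) F i).
Proof. by apply: big_ind; [exact: generated_one | exact: generated_mul]. Qed.

Lemma generated_exp x m : E x -> E (x ^+ m).
Proof.
move=> Ex; elim: m => [|m IH]; first exact: generated_one.
by rewrite exprS; apply: generated_mul.
Qed.

Lemma generated_exprz x (m : int) : E x -> E (x ^ m).
Proof.
by case: m => m Ex; [|apply: generated_inv]; apply: generated_exp.
Qed.

Lemma generated_nat m : E m%:R.
Proof.
elim: m => [|m IH]; first exact: generated_zero.
by rewrite -natr1; apply: generated_add => //; exact: generated_one.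
Qed.

Lemma generated_int (m : int) : E m%:~R.
Proof.
case: m => m; first exact: generated_nat.
by rewrite NegzE mulrNz; apply: generated_opp; exact: generated_nat.
Qed.

Lemma generated_det n (A : 'M_n) : (forall i j, E (A i j)) -> E (\det A).
Proof.
move=> EA; apply: generated_sum => s _; apply: generated_mul; last exact: generated_prod.
by apply/generated_exp/generated_opp; exact: generated_one.
Qed.

End GeneratedField.

Section TraceField.
Variables (R : realType) (N : nat) (T : ideal_triangulation N) (z : 'I_N -> R[i]).
Hypothesis z_ok : forall i, z i != 0 /\ z i != 1.

Lemma walk_end_cat i s s' : walk_end T i (s ++ s') = walk_end T (walk_end T i s) s'.
Proof. exact: foldl_cat. Qed.

Lemma holonomy_cat i s s' g g' :
  holonomy T z i s g -> holonomy T z (walk_end T i s) s' g' ->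
  holonomy T z i (s ++ s') (g *m g').
Proof.
elim: s i g => [|f s IH] i g /=; first by move=> ->; rewrite mul1mx.
move=> [g1 [g2 [h1 h2 ->]]] h'; exists g1, (g2 *m g').
by split; [|exact: IH|rewrite mulmxA].
Qed.

Lemma holonomy_det i s g : holonomy T z i s g -> \det g = 1.
Proof.
elim: s i g => [|f s IH] i g /=; first by move=> ->; rewrite det1.
by move=> [g1 [g2 [[d1 _] /IH d2 ->]]]; rewrite det_mulmx d1 d2 mulr1.
Qed.

Lemma face_pairing_inv i f g : face_pairing T z i f g ->
  face_pairing T z (glue T i f).1 ((glue T i f).2 f) (invmx g).
Proof.
move=> [dg gP]; have gu : g \in unitmx by rewrite unitmxE dg unitr1.
split=> [|w wf]; first by rewrite det_inv dg invr1.
rewrite glueK /=; set s := (glue T i f).2.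
have [u wu] : exists u, w = s u by exists ((s^-1)%g w); rewrite permKV.
move: wf; rewrite {w}wu permK (inj_eq perm_inj) => /gP[c gc].
have c0 : c != 0.
  apply/eqP => c0; move: gc; rewrite c0 scale0r => /(congr1 (mulmx (invmx g))).
  by rewrite mulKmx // mulmx0 => /eqP; rewrite (negPf (ideal_vertex_neq0 _ _)).
exists c^-1; by rewrite -[ideal_vertex (z i) u](scalerK c0) -gc -scalemxAr mulKmx.
Qed.

(** Walk back through the same faces. *)
Lemma holonomy_inv i s g : holonomy T z i s g ->
  exists2 s', walk_end T (walk_end T i s) s' = i &
    holonomy T z (walk_end T i s) s' (invmx g).
Proof.
elim: s i g => [|f s IH] i g /=; first by move=> ->; exists [::]; rewrite ?invmx1.
move=> [g1 [g2 [h1 h2 ->]]]; have [s' e hs'] := IH _ _ h2.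
have f1 := face_pairing_inv h1.
exists (s' ++ [:: (glue T i f).2 f]); first by rewrite walk_end_cat e /= glueK.
have g1u : g1 \in unitmx by rewrite unitmxE h1.1 unitr1.
have g2u : g2 \in unitmx by rewrite unitmxE (holonomy_det h2) unitr1.
have -> : invmx (g1 *m g2) = invmx g2 *m invmx g1 := invrM g1u g2u.
apply: holonomy_cat hs' _; rewrite e.
by exists (invmx g1), 1%:M; rewrite mulmx1.
Qed.

Lemma squares_conj i j s h m : holonomy T z i s h -> walk_end T i s = j ->
  squares (holonomy_group T z j) m ->
  squares (holonomy_group T z i) (h *m m *m invmx h).
Proof.
move=> hs <-; have [s' e hs'] := holonomy_inv hs.
have hu : h \in unitmx by rewrite unitmxE (holonomy_det hs) unitr1.
elim=> [|g m' [t [te ht]] _ IH]; first by rewrite mulmx1 mulmxV //; exact: squares_one.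
rewrite (_ : _ *m invmx h =
  (h *m g *m invmx h) *m (h *m g *m invmx h) *m (h *m m' *m invmx h)); last first.
  by rewrite !mulmxA !mulmxKV.
apply: squares_mul IH; exists (s ++ t ++ s'); split.
  by rewrite !walk_end_cat te.
by rewrite -mulmxA; apply: holonomy_cat => //; apply: holonomy_cat; rewrite ?te.
Qed.

(** Changing the base point conjugates the holonomy group, which preserves
    traces. *)
Lemma trace_squares_mem i j s m : walk_end T i s = j ->
  squares (holonomy_group T z j) m -> invariant_trace_field T z i (\tr m).
Proof.
move=> ij sq.
have [g gP] : exists g : 'I_N -> 'I_4 -> 'M[R[i]]_2,
    forall i f, face_pairing T z i f (g i f).
  have [g gP] := fin_all_exists
    (fun p : 'I_N * 'I_4 => face_pairing_exists T p.1 p.2 z_ok).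
  by exists (fun i f => g (i, f)) => i' f; exact: (gP (i', f)).
have hs := walk_holP gP i s; set h := walk_hol T g i s in hs.
have hu : h \in unitmx by rewrite unitmxE (holonomy_det hs) unitr1.
apply: generated_in; exists (h *m m *m invmx h); first exact: squares_conj hs ij sq.
by rewrite mxtrace_mulC mulmxA mulVmx // mul1mx.
Qed.

(** The quantifier over m' is what makes the statement inductive: it gives the
    traces of all products of factors g^2 - 1. *)
Lemma trace_ring_mem i j s m (Q := squares (holonomy_group T z j)) :
  walk_end T i s = j ->
  (forall m', Q m' -> invariant_trace_field T z i (\tr (m *m m'))) ->
  forall g, holonomy_group T z j g ->
  forall m', Q m' ->
    invariant_trace_field T z i (\tr (m *m (g *m g - 1%:M) *m m')).
Proof.
move=> ij mQ g gj m' Qm'.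
rewrite mulmxBr mulmx1 mulmxBl raddfB /= -!mulmxA.
apply: generated_sub; last exact: mQ.
by rewrite (mulmxA g); apply/mQ/squares_mul.
Qed.

(** With c_ab the determinant of the vectors of the vertices a and b, the traces
    of n_a n_b and of n_0 n_2 n_1 n_3 are, up to the factors c, - c_ab^2 and
    c_03 c_31 c_12 c_20; their quotient is the cross ratio
    c_02 c_13 / (c_03 c_12). *)
Lemma shape_mem i j s : walk_end T i s = j ->
  (forall v, exists g c, [/\ holonomy_group T z j g, c != 0 &
     g *m g = 1%:M + c *: shear (ideal_vertex (z j) v)]) ->
  invariant_trace_field T z i (z j).
Proof.
move=> ij gE; set E := invariant_trace_field T z i.
pose Q := squares (holonomy_group T z j).
pose ok m := forall m', Q m' -> E (\tr (m *m m')).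
have [g /fin_all_exists[c gcP]] := fin_all_exists gE.
pose n v := c v *: shear (ideal_vertex (z j) v).
have nE v : n v = g v *m g v - 1%:M by have [_ _ ->] := gcP v; rewrite addrC addKr.
have ok1 : ok 1%:M by move=> m' Qm'; rewrite mul1mx; exact: trace_squares_mem ij Qm'.
have okM m v : ok m -> ok (m *m n v).
  move=> okm m' Qm'; rewrite nE.
  by apply: trace_ring_mem ij okm _ _ _ Qm'; have [] := gcP v.
have ok_tr m : ok m -> E (\tr m).
  by move=> okm; rewrite -[m]mulmx1; apply/okm/squares_one.
have ok2 u v : E (\tr (n u *m n v)).
  by apply/ok_tr/okM; rewrite -[n u]mul1mx; exact: okM.
have ok4 : E (\tr (n v0 *m n v2 *m n v1 *m n v3)).
  by apply/ok_tr/okM/okM/okM; rewrite -[n v0]mul1mx; exact: okM.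
have c0 v : c v != 0 by have [] := gcP v.
have tr4 : \tr (n v0 *m n v2 *m n v1 *m n v3) = c v0 * c v2 * c v1 * c v3 * z j.
  rewrite tr_shear4 [cross (_ _ v3) _]crossC [cross (_ _ v2) (_ _ v0)]crossC.
  by rewrite !cross_ideal_vertex; ring.
have tr03 : \tr (n v0 *m n v3) = - (c v0 * c v3).
  by rewrite tr_shear2 cross_ideal_vertex expr1n mulr1.
have tr12 : \tr (n v1 *m n v2) = - (c v1 * c v2).
  by rewrite tr_shear2 cross_ideal_vertex sqrrN expr1n mulr1.
have E03 := ok2 v0 v3; rewrite tr03 in E03.
have E12 := ok2 v1 v2; rewrite tr12 in E12.
rewrite tr4 in ok4.
have -> : z j = c v0 * c v2 * c v1 * c v3 * z j / (- (c v0 * c v3) * - (c v1 * c v2)).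
  by field; rewrite !c0.
by apply: (generated_mul ok4); apply/generated_inv/generated_mul.
Qed.

End TraceField.

(** * Membership and invariance *)

Section Main.
Variables (R : realType) (n : nat) (T : ideal_triangulation n.+1).
Variables (mu : chain n.+1) (z : 'I_n.+1 -> R[i]).
Hypothesis cuspT : one_torus_cusp T.
Hypothesis mu_meridian : meridian_class T mu.
Hypothesis hyp : complete_hyperbolic T z ord0.
Implicit Types D : enhanced_NZ_datum T mu.

Let z_ok i : z i != 0 /\ z i != 1.
Proof. by case: hyp. Qed.

Let conn : forall x y, connect (link_step T) x y := cuspT.1.

Let cusp j v s h : closed_link_walk T j v s ->
  ~ null_homologous T (crossing_chain T (link_sides T j v s)) ->
  holonomy T z j s h -> parabolic h.
Proof. by case: hyp => _ _ _ _; apply. Qed.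

Lemma developing_data :
  exists (g : 'I_n.+1 -> 'I_4 -> 'M[R[i]]_2) (sc : cell n.+1 -> R[i]),
  (forall i f, face_pairing T z i f (g i f)) /\
  (forall i v f, v != f ->
     g i f *m ideal_vertex (z (glue T i f).1) ((glue T i f).2 v) =
     sc (i, v, f) *: ideal_vertex (z i) v).
Proof.
have [g gP] := fin_all_exists
  (fun p : 'I_n.+1 * 'I_4 => face_pairing_exists T p.1 p.2 z_ok).
have scE (x : cell n.+1) : exists c, x.1.2 != x.2 ->
    g (x.1.1, x.2) *m
      ideal_vertex (z (glue T x.1.1 x.2).1) ((glue T x.1.1 x.2).2 x.1.2) =
    c *: ideal_vertex (z x.1.1) x.1.2.
  have [e|ne] := eqVneq x.1.2 x.2; first by exists 0.
  by have [_ /(_ _ ne)[c gc]] := gP (x.1.1, x.2); exists c.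
have [sc scP] := fin_all_exists scE.
exists (fun i f => g (i, f)), sc; split=> [i f|i v f]; first exact: (gP (i, f)).
exact: (scP (i, v, f)).
Qed.

Lemma z_mem D i : invariant_trace_field T z ord0 (z i).
Proof.
have [g [sc [gP scP]]] := developing_data.
have [x0 [s0 ess0]] := essential_loop mu_meridian.2 (nz_loopP D).
have [t [_ te]] := connect_link_walk (conn (ord0, v0) (i, v0)).
apply: (shape_mem z_ok (s := t)); first by rewrite -(link_walk_endE T ord0 v0) te.
move=> v; have [s ess] := essential_at (i, v) conn ess0.
have [sw s_n0] := ess; have hol := walk_holP gP i s.
have [tr2 h1 hN1] : parabolic (walk_hol T g i s) by apply: cusp s_n0 hol.
have two_neq0 : (2%:R : R[i]) != 0 by rewrite pnatr_eq0.
have [c c0 cE] := parabolic_square two_neq0 (ideal_vertex_neq0 (z i) v)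
  (walk_hol_vertex scP sw) (essential_multiplier gP scP cusp ess)
  (det_walk_hol gP i s) tr2 h1 hN1.
exists (walk_hol T g i s), c; split=> //; exists s; split=> //.
by rewrite -(link_walk_endE T i v) sw.2.
Qed.

Lemma tau_mem D : invariant_trace_field T z ord0 (tau D z).
Proof.
set E := invariant_trace_field T z ord0.
have Ekap i k : E (kappa (z i) k).
  case: (ord3P k) => ->; rewrite /kappa /=.
  - by apply: generated_sub; [exact: generated_one|exact: z_mem].
  - exact: z_mem.
  by apply/generated_opp/generated_one.
have Eshape i k : E (shape (z i) k).
  rewrite shape_kappa ?(z_ok i).1 ?(z_ok i).2 //.
  by apply: generated_mul; [apply/generated_opp/Ekap|apply/generated_inv/Ekap].
rewrite /tau (tau_matrix z_ok) det_mulmx det_diag.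
apply: generated_mul; last first.
  apply: generated_prod => i _.
  by apply: generated_mul; apply: generated_exprz; exact: Eshape.
apply: generated_mul; first by apply/generated_inv/generated_nat.
apply: generated_mul.
  apply: generated_det => r i; rewrite mxE; apply: generated_sum => k _.
  by apply: generated_mul; [exact: generated_int|exact: Ekap].
apply: generated_prod => i _; rewrite mxE.
by apply/generated_opp/generated_inv/Ekap.
Qed.

Lemma tau_sq_invariant D D' : tau D z ^+ 2 = tau D' z ^+ 2.
Proof.
have [g [sc [gP scP]]] := developing_data.
have [x0 [s0 ess0]] := essential_loop mu_meridian.2 (nz_loopP D).
have [h [L [h0 h_const L0 hL]]] := edge_lengths z_ok gP scP cusp conn ess0.
rewrite !(tau_sq z_ok) !exprMn.
rewrite (det_weighted_gluing (fun i => sum_kappa (z i)) D D').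
by rewrite (flat_monomial_invariant z_ok D D' h0 h_const L0 hL).
Qed.
End Main.

Theorem theorem1p3 (R : realType) (n : nat) (T : ideal_triangulation n.+1)
    (mu : chain n.+1) (z : 'I_n.+1 -> R[i]) :
  one_torus_cusp T ->
  meridian_class T mu ->
  complete_hyperbolic T z ord0 ->
  (forall D : enhanced_NZ_datum T mu,
     invariant_trace_field T z ord0 (tau D z)) /\
  (forall D D' : enhanced_NZ_datum T mu,
     tau D z = tau D' z \/ tau D z = - tau D' z).
Proof.
move=> cuspT mu_meridian hyp; split=> [D|D D']; first exact: tau_mem.
have := tau_sq_invariant cuspT mu_meridian hyp D D'.
by move/eqP; rewrite eqf_sqr => /orP[]/eqP; [left|right].
Qed.
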